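(* Let $T>0$ and let $a\in L^p[0,T]$, $b\in L^q[0,T]$, $c\in L^r[0,T]$ with $p\in[2,\infty]$, $q\in(1,\infty]$, $r\in[1,\infty]$ be such that $1/p+1/r\ge\frac12$ and $1/p+1/q+1/r<\frac32$. Then the stochastic process $$X_t=\int_0^t\left(a(s)\int_s^t b(u)\,c(u-s)\,du\right)dW_s,\qquad t\in[0,T],$$ has a modification satisfying the Hölder condition up to order $\frac32-1/p-1/q-1/r$ on $[0,T]$.
   Context: $W$ is a standard Wiener process; the stochastic integral is the Wiener integral of a deterministic function. A process satisfies the Hölder condition up to order $\lambda>0$ on an interval if its trajectories satisfy the $\gamma$-Hölder condition on that interval (with a finite random constant depending on $\gamma$) for every $\gamma\in(0,\lambda)$. Convention: $1/\infty=0$. *)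

(* Defs.v *)
From mathcomp Require Export all_boot all_order all_algebra.
From mathcomp Require Export all_classical all_reals all_analysis.

Set Implicit Arguments.
Unset Strict Implicit.
Unset Printing Implicit Defensive.

Import Order.TTheory GRing.Theory Num.Theory.
Import numFieldNormedType.Exports.

Local Open Scope classical_set_scope.
Local Open Scope ring_scope.

(* A real function [f] represents an element of L^p(D); its values outside of
   [D] are irrelevant. *)
Definition Lp_on (R : realType) (D : set R) (p : \bar R) (f : R -> R) : Prop :=
  f \_ D \in Lfun (@lebesgue_measure R) p.

(* Taking some of the [A i] to be the whole line gives the product rule for
   every subfamily, so that this is mutual independence of the increments. *)
Definition independent_increments (R : realType) (d : measure_display)
    (Omega : measurableType d) (P : probability Omega R)
    (W : R -> {RV P >-> R}) : Prop :=
  forall (n : nat) (t : nat -> R) (A : nat -> set R),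
    0 <= t 0%N ->
    (forall i, (i < n)%N -> t i <= t i.+1) ->
    (forall i, measurable (A i)) ->
    P (\bigcap_(i < n) [set w | A i (W (t i.+1) w - W (t i) w)]) =
    (\prod_(i < n) P [set w | A i (W (t i.+1) w - W (t i) w)%R])%E.

(* The time set is [0, +oo[; the values of [W] at negative times are
   irrelevant. [normal_prob m s] has mean [m] and standard deviation [s]. *)
Record standard_wiener (R : realType) (d : measure_display)
    (Omega : measurableType d) (P : probability Omega R)
    (W : R -> {RV P >-> R}) : Prop := {
  wiener_start : {ae P, forall w, W 0 w = 0} ;
  wiener_independent : independent_increments W ;
  wiener_gaussian : forall s t : R, 0 <= s -> s < t ->
    forall A : set R, measurable A ->
      P [set w | A (W t w - W s w)] = normal_prob 0 (Num.sqrt (t - s)) A ;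
  wiener_continuous :
    {ae P, forall w, {within `[0, +oo[, continuous (fun t : R => W t w)}}
}.

(* The triples [((u, v), x)] of [h] encode the step function that is the sum of
   the [x * \1_(]u, v])]; the intervals may overlap. *)
Definition step_on (R : realType) (t : R) (h : seq (R * R * R)) : bool :=
  all (fun j => [&& 0 <= j.1.1, j.1.1 <= j.1.2 & j.1.2 <= t]) h.

Definition step_fun (R : realType) (h : seq (R * R * R)) (s : R) : R :=
  \sum_(j <- h) j.2 * \1_(`]j.1.1, j.1.2]) s.

Definition step_integral (R : realType) (d : measure_display)
    (Omega : measurableType d) (P : probability Omega R)
    (W : R -> {RV P >-> R}) (h : seq (R * R * R)) (w : Omega) : R :=
  \sum_(j <- h) j.2 * (W j.1.2 w - W j.1.1 w).

(* [Y] is (a version of) the Wiener integral of [f] over [0, t]: the L^2(P)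
   limit of the integrals of step functions converging to [f] in L^2[0, t]. By
   the isometry it exists and is unique up to almost sure equality as soon as
   [f] is in L^2[0, t]. *)
Definition is_wiener_integral (R : realType) (d : measure_display)
    (Omega : measurableType d) (P : probability Omega R)
    (W : R -> {RV P >-> R}) (t : R) (f : R -> R) (Y : {RV P >-> R}) : Prop :=
  Lp_on `[0, t] 2%:E f /\
  exists h : nat -> seq (R * R * R),
    [/\ forall n, step_on t (h n),
        Lnorm (@lebesgue_measure R) 2%:E
          (EFin \o (step_fun (h n) \- f) \_ `[0, t]) @[n --> \oo] --> 0%E
      & Lnorm P 2%:E (EFin \o (step_integral W (h n) \- Y))
          @[n --> \oo] --> 0%E].

Definition conv_integrand (R : realType) (b c : R -> R) (s u : R) : R :=
  b u * c (u - s).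

Definition volterra_kernel (R : realType) (a b c : R -> R) (t s : R) : R :=
  a s * \int[@lebesgue_measure R]_(u in `[s, t]) conv_integrand b c s u.

(* [Rintegral] is total, hence the explicit requirement that the inner integral
   converges for almost all [s]. *)
Definition volterra_well_defined (R : realType) (T : R) (a b c : R -> R) :
    Prop :=
  forall t : R, t \in `[0, T] ->
    {ae @lebesgue_measure R, forall s, s \in `[0, t] ->
       (@lebesgue_measure R).-integrable `[s, t]
         (EFin \o conv_integrand b c s)} /\
    Lp_on `[0, t] 2%:E (volterra_kernel a b c t).

Definition modification_on (R : realType) (d : measure_display)
    (Omega : measurableType d) (P : probability Omega R) (D : set R)
    (X Y : R -> {RV P >-> R}) : Prop :=
  forall t, D t -> P [set w | X t w = Y t w] = 1%E.

Definition holder_up_to (R : realType) (d : measure_display)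
    (Omega : measurableType d) (P : probability Omega R) (D : set R)
    (lambda : \bar R) (Y : R -> {RV P >-> R}) : Prop :=
  forall gamma : R, 0 < gamma -> (gamma%:E < lambda)%E ->
    exists C : {RV P >-> R}, forall w s t, D s -> D t ->
      `|Y t w - Y s w| <= C w * `|t - s| `^ gamma.

(* Main.v *)
(* With [alpha = 1/p], [beta = 1/q], [rho = 1/r], the kernel increment between
   [s] and [t] is [a] times the integral of [b] against a translate of [c] over
   ]s, t]. Hoelder in the variable of [a], Young's convolution inequality and
   Hoelder in [b] on an interval of length [t - s] bound its L^2 norm by
   [K (t - s)^lambda], [lambda = 3/2 - alpha - beta - rho]. Wiener integrals of
   step functions have Gaussian exponential moments, and this gives exponential
   tails for [X_t - X_s] on the scale [(t - s)^lambda] in the L^2 limit. Tails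
   of this kind are summable over dyadic grids at every exponent below [lambda],
   so that Borel-Cantelli and dyadic interpolation provide the modification. *)
Require Import Defs.
From HB Require Import structures.
From mathcomp Require Import measurable_realfun ess_sup_inf ring lra zify.
Set Implicit Arguments.
Unset Strict Implicit.
Unset Printing Implicit Defensive.
Import Order.TTheory GRing.Theory Num.Theory.
Import numFieldNormedType.Exports.
Local Open Scope classical_set_scope.
Local Open Scope ring_scope.

(** * Hoelder's inequality for powers of integrable functions *)

(** The exponent conditions are those of Young's inequality. With e = 1/2 - alpha, the convolution
    must lie in L^(1/e), so Young needs [b] in L^(1/beta') with beta' = 3/2 - alpha - rho. The
    assumption alpha + rho >= 1/2 says that beta' <= 1, and alpha + beta + rho < 3/2 says that beta
    < beta'. The gap beta' - beta is lambda: it is the power of t - s gained when [b] is put into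
    L^(1/beta') of [s, t]. The inner domain [v, t] of the kernel depends on the outer variable v.
    Extending [c] by zero to negative arguments turns it into [0, t], so that the increment is a
    single integral over ]s, t] for every v, also for v between s and t. Each X_t is given only as
    an L^2 limit, separately for every t. The law of the limit is never identified: the tail bound
    for step integrals passes to the limit because Chebyshev's inequality makes the approximation
    error arbitrarily improbable. Afterwards only the countably many values on dyadic grids matter,
    which also makes the random Hoelder constant measurable. *)

Lemma measurable_fun_powR d (T : measurableType d) (R : realType) (D : set T)
    (f : T -> R) (t : R) :
  measurable_fun D f -> measurable_fun D (fun x => f x `^ t).
Proof. exact: (@measurableT_comp _ _ _ _ _ _ (fun x => x `^ t)). Qed.

Lemma powR_le_expR (R : realType) (x y : R) :
  0 <= x -> 0 <= y -> x `^ y <= expR (y * (x - 1)).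
Proof.
move=> x0 y0; rewrite /powR; case: eqP => [->|/eqP xn0].
  case: eqP => [->|_]; last exact: expR_ge0.
  by rewrite mul0r expR0.
rewrite ler_expR ler_wpM2l//.
have xgt0 : 0 < x by rewrite lt_neqAle eq_sym xn0.
rewrite -ler_expR lnK ?posrE//.
by have := expR_ge1Dx (x - 1); rewrite addrC subrK.
Qed.

Lemma powR_agm3 (R : realType) (a b c x y z : R) :
  0 <= a -> 0 <= b -> 0 <= c -> a + b + c = 1 ->
  0 <= x -> 0 <= y -> 0 <= z ->
  x `^ a * y `^ b * z `^ c <= a * x + b * y + c * z.
Proof.
move=> a0 b0 c0 abc x0 y0 z0; set m := a * x + b * y + c * z.
have ax0 : 0 <= a * x by exact: mulr_ge0.
have by0 : 0 <= b * y by exact: mulr_ge0.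
have cz0 : 0 <= c * z by exact: mulr_ge0.
have [m0|m0] := ltP 0 m; last first.
  have /eqP ax : a * x == 0 by rewrite eq_le; apply/andP; split;
    rewrite /m in m0; lra.
  have /eqP by_ : b * y == 0 by rewrite eq_le; apply/andP; split;
    rewrite /m in m0; lra.
  have /eqP cz : c * z == 0 by rewrite eq_le; apply/andP; split;
    rewrite /m in m0; lra.
  rewrite /m ax by_ cz !addr0.
  have z0' (u v : R) : u != 0 -> u * v = 0 -> v `^ u = 0.
    move=> un0 /eqP; rewrite mulf_eq0 (negbTE un0)/= => /eqP ->.
    by rewrite powR0.
  have [ae|/z0'/(_ ax) ->] := eqVneq a 0; last by rewrite !mul0r.
  have [be|/z0'/(_ by_) ->] := eqVneq b 0; last by rewrite mulr0 mul0r.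
  have [ce|/z0'/(_ cz) ->] := eqVneq c 0; last by rewrite mulr0.
  by move: abc; rewrite ae be ce !addr0 => /eqP; rewrite eq_sym oner_eq0.
have mge0 := ltW m0; have mn0 : m != 0 by rewrite gt_eqF.
have powE (u t : R) : 0 <= u -> u `^ t = (u / m) `^ t * m `^ t.
  by move=> u0; rewrite -powRM ?divr_ge0// divfK.
rewrite (powE x)// (powE y)// (powE z)//.
set X := _ `^ a; set Y := (y / m) `^ b; set Z := (z / m) `^ c.
have -> : X * m `^ a * (Y * m `^ b) * (Z * m `^ c) =
    X * Y * Z * (m `^ a * m `^ b * m `^ c) by ring.
rewrite -!powRD ?mn0 ?implybT// abc powRr1//.
rewrite ler_piMl//.
apply: (@le_trans _ _ (expR (a * (x / m - 1)) * expR (b * (y / m - 1)) * expR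
  (c * (z / m - 1)))).
  by rewrite !ler_pM ?mulr_ge0 ?powR_ge0// powR_le_expR// divr_ge0.
rewrite -!expRD -[leRHS]expR0 ler_expR.
have -> : a * (x / m - 1) + b * (y / m - 1) + c * (z / m - 1) = m / m -
  (a + b + c).
  have -> : m / m = (a * x + b * y + c * z) / m by [].
  by clearbody m; field.
by rewrite divff// abc subrr.
Qed.

(** The scales are meant to be bounds of the integrals of the three functions: integrating the
    right-hand sum then yields at most a + b + c = 1. *)
Lemma powR_agm3_scaled (R : realType) (a b c x y z k l m : R) :
  0 <= a -> 0 <= b -> 0 <= c -> a + b + c = 1 ->
  0 <= x -> 0 <= y -> 0 <= z -> 0 < k -> 0 < l -> 0 < m ->
  x `^ a * y `^ b * z `^ c <=
  k `^ a * l `^ b * m `^ c * (a / k * x + b / l * y + c / m * z).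
Proof.
move=> a0 b0 c0 abc x0 y0 z0 k0 l0 m0.
have powE (u t v : R) : 0 < v -> 0 <= u -> u `^ t = (u / v) `^ t * v `^ t.
  by move=> v0 u0; rewrite -powRM ?divr_ge0 ?(ltW v0)// divfK ?gt_eqF.
rewrite (powE x a k)// (powE y b l)// (powE z c m)//.
set X := (x / k) `^ a; set Y := (y / l) `^ b; set Z := (z / m) `^ c.
have -> : X * k `^ a * (Y * l `^ b) * (Z * m `^ c) =
  k `^ a * l `^ b * m `^ c * (X * Y * Z) by ring.
apply: ler_wpM2l; first by rewrite !mulr_ge0 ?powR_ge0.
apply: le_trans (powR_agm3 a0 b0 c0 abc _ _ _) _.
- by rewrite divr_ge0// ltW.
- by rewrite divr_ge0// ltW.
- by rewrite divr_ge0// ltW.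
by rewrite !(mulrAC _ _^-1) !mulrA.
Qed.

Section hoelder_generalized.
Context d (T : measurableType d) (R : realType).
Variable mu : {measure set T -> \bar R}.
Variables (D : set T) (mD : measurable D).

(** Stated for powers of integrable functions, so that finite and infinite Lebesgue exponents need
    no separate treatment. Positive upper bounds replace the integrals themselves, which could be 0
    and could not be divided by. *)
Lemma ge0_integral_hoelder3 (f g h : T -> R) (a b c k l m : R) :
  0 <= a -> 0 <= b -> 0 <= c -> a + b + c = 1 -> 0 < k -> 0 < l -> 0 < m ->
  measurable_fun D f -> measurable_fun D g -> measurable_fun D h ->
  (forall x, 0 <= f x) -> (forall x, 0 <= g x) -> (forall x, 0 <= h x) ->
  (\int[mu]_(x in D) (f x)%:E <= k%:E)%E ->
  (\int[mu]_(x in D) (g x)%:E <= l%:E)%E ->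
  (\int[mu]_(x in D) (h x)%:E <= m%:E)%E ->
  (\int[mu]_(x in D) (f x `^ a * g x `^ b * h x `^ c)%:E <=
   (k `^ a * l `^ b * m `^ c)%:E)%E.
Proof.
move=> a0 b0 c0 abc k0 l0 m0 mf mg mh f0 g0 h0 fk gl hm.
have mZ (u : T -> R) t : measurable_fun D u -> measurable_fun D (EFin \o
  (fun x => t * u x)).
  by move=> mu_; apply/measurable_EFinP/measurable_funM.
have ge0Z (u : T -> R) t : 0 <= t -> (forall x, 0 <= u x) -> forall x, D x ->
  (0 <= (t * u x)%:E)%E.
  by move=> t0 u0 x _; rewrite lee_fin mulr_ge0.
have ak : 0 <= a / k by rewrite divr_ge0// ltW.
have bl : 0 <= b / l by rewrite divr_ge0// ltW.
have cm : 0 <= c / m by rewrite divr_ge0// ltW.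
set K := k `^ a * _ * _.
have K0 : 0 <= K by rewrite !mulr_ge0 ?powR_ge0.
apply: (@le_trans _ _ (\int[mu]_(x in D) (K%:E * ((a / k * f x)%:E +
  (b / l * g x)%:E + (c / m * h x)%:E)))%E).
  apply: ge0_le_integral => //.
  - by move=> x _; rewrite lee_fin !mulr_ge0 ?powR_ge0.
  - by apply/measurable_EFinP; apply: measurable_funM;
      [apply: measurable_funM|]; exact: measurable_fun_powR.
  - apply: measurable_funeM; apply: emeasurable_funD;
      [apply: emeasurable_funD|]; exact: mZ.
  - by move=> x _; rewrite -!EFinD -EFinM lee_fin powR_agm3_scaled.
rewrite ge0_integralZl//; last 2 first.
- apply: emeasurable_funD; [apply: emeasurable_funD|]; exact: mZ.
- by move=> x Dx; rewrite !adde_ge0// ge0Z.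
rewrite -[leRHS]mule1; apply: lee_wpmul2l => //.
rewrite ge0_integralD//; last 4 first.
- by move=> x Dx; rewrite !adde_ge0// ge0Z.
- apply: emeasurable_funD => //; exact: mZ.
- exact: ge0Z.
- exact: mZ.
rewrite ge0_integralD//; try exact: ge0Z; try exact: mZ.
have bnd (u : T -> R) s t : 0 <= s -> 0 < t -> (forall x, 0 <= u x) ->
  measurable_fun D u ->
   (\int[mu]_(x in D) (u x)%:E <= t%:E)%E -> (\int[mu]_(x in D)
     (s / t * u x)%:E <= s%:E)%E.
  move=> s0 t0 u0 mu_ ut.
  under eq_integral do rewrite EFinM.
  have st0 : (0 <= (s / t)%:E)%E by rewrite lee_fin divr_ge0// ltW.
  rewrite ge0_integralZl//; last 2 first.
  - exact/measurable_EFinP.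
  - by move=> x _; rewrite lee_fin.
  apply: le_trans (lee_wpmul2l st0 ut) _.
  by rewrite -EFinM divfK// gt_eqF.
by rewrite -abc !EFinD !leeD// bnd.
Qed.

End hoelder_generalized.

(** * Translations and Lebesgue spaces *)

Section lebesgue_translation.
Context {R : realType}.
Notation mu := (@lebesgue_measure R).
Local Open Scope ereal_scope.

Lemma measurable_shift (v : R) : measurable_fun [set: R] (fun x : R => (x - v)%R).
Proof. exact: measurable_funB. Qed.

Lemma lebesgue_measure_shift (v : R) (A : set R) : measurable A ->
  pushforward mu (fun x : R => (x - v)%R : measurableTypeR R) A = mu A.
Proof.
move=> mA; apply/esym/lebesgue_measure_unique => //=.
  exact: measurable_shift.
move=> mf _ [[a b]] _ <-; rewrite /pushforward.
have -> : (fun x : R => (x - v)%R) @^-1` `]a, b] = `](a + v)%R,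
  (b + v)%R]%classic.
  by apply/seteqP; split => x /=; rewrite !in_itv/= ltrBrDr lerBlDr.
rewrite !lebesgue_measure_itv/= !lte_fin ltrD2r; case: ifPn => // _.
by rewrite -!EFinB opprD addrACA subrr addr0.
Qed.

Lemma ge0_integral_shift (f : R -> \bar R) (v : R) :
  measurable_fun [set: R] f -> (forall x, 0 <= f x) ->
  \int[mu]_u f (u - v)%R = \int[mu]_u f u.
Proof.
move=> mf f0; have ms := measurable_shift v.
transitivity (\int[pushforward mu (fun x : R => (x - v)%R :
  measurableTypeR R)]_x f x).
  by rewrite ge0_integral_pushforward.
by apply: eq_measure_integral => A mA _; exact: lebesgue_measure_shift.
Qed.

Lemma ae_lebesgue_shift (Q : set R) (v : R) :
  {ae mu, forall x, Q x} -> {ae mu, forall u, Q (u - v)%R}.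
Proof.
move=> [N [mN N0 QN]]; exists ((fun x : R => (x - v)%R) @^-1` N); split.
- by rewrite -[X in measurable X]setTI; exact: measurable_shift.
- by have := lebesgue_measure_shift v mN; rewrite N0.
- by move=> u /= Qu; exact: QN.
Qed.

End lebesgue_translation.

Lemma Lp_on_measurable (R : realType) (D : set R) (p : \bar R) (f : R -> R) :
  Lp_on D p f -> measurable_fun [set: R] (f \_ D).
Proof. by rewrite /Lp_on inE => /andP[/[!inE]]. Qed.

(* All exponents are treated alike through [fine p^-1]: for [p = +oo] it is [0],
   and [0 `^ 0 = 1], so that [M] is then an essential bound of [f]. *)
Lemma Lp_on_powR_le (R : realType) (D : set R) (p : \bar R) (f : R -> R) :
  (1 <= p)%E -> Lp_on D p f -> exists (M : R) (F : R -> R),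
    [/\ 0 < M, measurable_fun [set: R] F, forall x, 0 <= F x,
        (\int[@lebesgue_measure R]_x (F x)%:E < +oo)%E &
        {ae @lebesgue_measure R, forall x,
           `|(f \_ D) x| <= M * F x `^ fine (p^-1)%E}].
Proof.
move=> p1 Lf; have mf := Lp_on_measurable Lf.
case: p p1 Lf => [p|_|//].
- rewrite lee_fin => p1 Lf; have p0 : p != 0 by rewrite gt_eqF//
    (lt_le_trans _ p1).
  exists 1, (fun x => `|(f \_ D) x| `^ p); split => //.
  + by apply: measurable_fun_powR; exact: measurableT_comp.
  + have /integrableP[_] := Lfun_integrable p1 Lf.
    by under eq_integral do rewrite gee0_abs ?lee_fin ?powR_ge0//.
  + apply: nearW => x; rewrite mul1r inver (negbTE p0)/= -powRrM divff//.
    by rewrite powRr1.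
- rewrite /Lp_on inE => /andP[_]; rewrite inE/= /finite_norm unlock.
  have -> : (0 < @lebesgue_measure R [set: R])%E
    by rewrite -set_itvNyy lebesgue_measure_itv/= ltry.
  set s := ess_sup _ _ => sy.
  exists (`|fine s| + 1), (cst 0); split => //.
  + by rewrite integral0.
  + have := ess_sup_ge (@lebesgue_measure R) (abse \o (EFin \o (f \_ D))).
    apply: filterS => x /=; rewrite -/s => fs; rewrite powRr0 mulr1.
    have : (`|(f \_ D) x|%:E <= (`|fine s|)%:E)%E.
      apply: (le_trans fs); have sfin : s \is a fin_num.
        rewrite ge0_fin_numE//.
        by apply: le_trans fs; rewrite lee_fin.
      by rewrite -(fineK sfin) lee_fin/= ler_norm.
    by rewrite lee_fin => /le_trans; apply; rewrite lerDl.
Qed.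

(** * Young's inequality on a short interval *)

Lemma ae_lebesgueS (R : realType) (P Q : R -> Prop) :
  (forall x, P x -> Q x) ->
  {ae @lebesgue_measure R, forall x, P x} -> {ae @lebesgue_measure R, forall x,
    Q x}.
Proof. by apply: filterS; exact: (ae_filter_ringOfSetsType
  (@lebesgue_measure R)). Qed.

Lemma ae_lebesgueS2 (R : realType) (P Q S : R -> Prop) :
  (forall x, P x -> Q x -> S x) ->
  {ae @lebesgue_measure R, forall x, P x} -> {ae @lebesgue_measure R, forall x,
    Q x} ->
  {ae @lebesgue_measure R, forall x, S x}.
Proof. by apply: filterS2; exact: (ae_filter_ringOfSetsType
  (@lebesgue_measure R)). Qed.

(** At base 0 either one exponent is 0, and 0^0 = 1 gives the identity, or both sides vanish. *)
Lemma ge0_powRD (R : realType) (x r s : R) : 0 <= r -> 0 <= s ->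
  x `^ (r + s) = x `^ r * x `^ s.
Proof.
move=> r0 s0; have [x0|xn0] := eqVneq x 0; last by rewrite powRD// xn0 implybT.
rewrite x0; have [->|rn0] := eqVneq r 0; first by rewrite add0r powRr0 mul1r.
by rewrite powR0 ?paddr_eq0 ?(negbTE rn0)// powR0// mul0r.
Qed.

Section young_estimate.
Context {R : realType}.
Notation mu := (@lebesgue_measure R).

Lemma ge0_integral_reflect (f : R -> \bar R) (v : R) :
  measurable_fun [set: R] f -> (forall x, 0 <= f x)%E ->
  (\int[mu]_u f (v - u)%R = \int[mu]_u f u)%E.
Proof.
move=> mf f0; pose phi (x : R) : measurableTypeR R := v - x.
have mphi : measurable_fun [set: R] phi by exact: measurable_funB.
transitivity (\int[pushforward mu phi]_x f x)%E.
  by rewrite ge0_integral_pushforward.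
apply: eq_measure_integral => A mA _; apply/esym.
apply: lebesgue_measure_unique => //= _ [[a b]] _ <-; rewrite /pushforward.
have -> : phi @^-1` `]a, b] = `[v - b, v - a[%classic.
  by apply/seteqP; split => x /=; rewrite !in_itv/= /phi => /andP[h1 h2];
    apply/andP; split; lra.
rewrite !lebesgue_measure_itv/= !lte_fin.
have -> : (v - b < v - a) = (a < b) by apply/idP/idP => ?; lra.
by case: ifPn => // _; rewrite -!EFinB; congr (_%:E); ring.
Qed.

Variables (E : set R) (mE : measurable E).
Variables (alpha beta rho : R) (a b c A B C : R -> R) (Ma Mb Mc kA kB kC kE : R).
Hypotheses (alpha0 : 0 <= alpha) (alpha2 : alpha <= 1 / 2) (beta0 : 0 <= beta).
Hypotheses (rho1 : rho <= 1) (ar : 1 / 2 <= alpha + rho).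
Hypothesis (abr : alpha + beta + rho < 3 / 2).
Hypotheses (ma : measurable_fun [set: R] a) (mb : measurable_fun [set: R] b)
  (mc : measurable_fun [set: R] c).
Hypotheses (mA : measurable_fun [set: R] A) (mB : measurable_fun [set: R] B)
  (mC : measurable_fun [set: R] C).
Hypotheses (A0 : forall x, 0 <= A x) (B0 : forall x, 0 <= B x)
  (C0 : forall x, 0 <= C x).
Hypotheses (Ma0 : 0 < Ma) (Mb0 : 0 < Mb) (Mc0 : 0 < Mc).
Hypotheses (kA0 : 0 < kA) (kB0 : 0 < kB) (kC0 : 0 < kC) (kE0 : 0 < kE).
Hypotheses (intA : (\int[mu]_x (A x)%:E <= kA%:E)%E)
  (intB : (\int[mu]_x (B x)%:E <= kB%:E)%E)
  (intC : (\int[mu]_x (C x)%:E <= kC%:E)%E) (intE : (mu E <= kE%:E)%E).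
Hypotheses (aA : {ae mu, forall x, `|a x| <= Ma * A x `^ alpha})
  (bB : {ae mu, forall x, `|b x| <= Mb * B x `^ beta})
  (cC : {ae mu, forall x, `|c x| <= Mc * C x `^ rho}).

(** The bookkeeping: alpha + e = 1/2 for the product of [a] with the convolution, 1 + e = beta' +
    rho for the convolution, and lambda = beta' - beta. *)
Let e := 1 / 2 - alpha.
Let beta' := 3 / 2 - alpha - rho.
Let theta := beta / beta'.
Let lambda := 3 / 2 - alpha - beta - rho.

Let e0 : 0 <= e. Proof. by rewrite subr_ge0. Qed.
Let rhoe0 : 0 <= rho - e. Proof. by rewrite subr_ge0 lerBlDl. Qed.
Let rho10 : 0 <= 1 - rho. Proof. by rewrite subr_ge0. Qed.
Let beta_lt : beta < beta'.
Proof. by rewrite /beta' -addrA -opprD ltrBrDr addrCA addrA. Qed.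
Let beta'0 : 0 < beta'. Proof. exact: le_lt_trans beta_lt. Qed.
Let theta0 : 0 <= theta. Proof. by rewrite divr_ge0// ltW. Qed.
Let theta1 : 0 <= 1 - theta.
Proof. by rewrite subr_ge0 ler_pdivrMr// mul1r ltW. Qed.
Let thetaM : theta * beta' = beta.
Proof. by rewrite /theta divfK// gt_eqF. Qed.

(** What remains of the estimate after the power of t - s is split off. No endpoint of the interval
    occurs in it, so one constant serves all increments. *)
Definition young_const : R :=
  (Ma * Mb * Mc) ^+ 2 * kC `^ (rho - e) ^+ 2 * kA `^ (alpha + alpha)
  * (kC * (1 + kE)) `^ (e + e) * kB `^ (2 * beta).

Section young_interval.
Variables (s t : R) (st : s < t).

Let D : set R := `[s, t].
Let mD : measurable D. Proof. exact: measurable_itv. Qed.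
Let muD : mu D = (t - s)%:E.
Proof. by rewrite lebesgue_measure_itv/= lte_fin st EFinB. Qed.
(** Since theta * beta' = beta, the bound B^beta of [b] is F^beta' on the interval, and the integral
    of [F] is at most [MF], which carries the power 1 - theta of t - s. *)
Let F u := B u `^ theta * \1_D u.
Let MF := kB `^ theta * (t - s) `^ (1 - theta).
Let H v := (\int[mu]_u (F u * C (u - v))%:E)%E.
Let J v := (\int[mu]_(u in D) `|b u * c (u - v)|%:E)%E.
Let kappa := MF * kC.

Let ts0 : 0 < t - s. Proof. by rewrite subr_gt0. Qed.
Let MF0 : 0 < MF. Proof. by rewrite mulr_gt0// powR_gt0. Qed.
Let kappa0 : 0 < kappa. Proof. exact: mulr_gt0. Qed.
Let F0 u : 0 <= F u. Proof. by rewrite mulr_ge0// powR_ge0. Qed.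
Let mF : measurable_fun [set: R] F.
Proof.
apply: measurable_funM; first exact: measurable_fun_powR.
exact: measurable_indic.
Qed.

Let intDF : (\int[mu]_(u in D) (F u)%:E <= MF%:E)%E.
Proof.
(* Hoelder against the constant 1; the third factor has exponent 0, and 0^0 = 1 makes it trivial. *)
have := @ge0_integral_hoelder3 _ _ _ mu D mD B (cst 1) (cst 0) theta (1 - theta) 0
  kB (t - s) 1.
rewrite powRr0 mulr1 -/MF => h; apply: le_trans
  (h _ _ _ _ _ _ _ _ _ _ _ _ _ _ _ _) => //.
- apply: ge0_le_integral => //.
  + by move=> x _; rewrite lee_fin.
  + by apply/measurable_EFinP/measurable_funTS.
  + apply/measurable_EFinP; apply: measurable_funTS => /=.
    by do 2 (apply: measurable_funM => //); exact: measurable_fun_powR.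
  + move=> x Dx; rewrite lee_fin /F indicE mem_set// powR1 powRr0.
    by rewrite !mulr1.
- by rewrite addr0 addrC subrK.
- exact: measurable_funTS.
- apply: le_trans intB; apply: ge0_subset_integral => //.
  + exact/measurable_EFinP.
  + by move=> x _; rewrite lee_fin.
- rewrite (@integral_cst _ _ _ mu D mD 1%E) mul1e.
  by rewrite le_eqVlt; apply/orP; left; apply/eqP; exact: muD.
- by rewrite integral0 lee_fin.
Qed.

Let intF : (\int[mu]_u (F u)%:E <= MF%:E)%E.
Proof.
apply: le_trans intDF; rewrite [leRHS]integral_mkcond le_eqVlt; apply/orP; left.
apply/eqP; apply: eq_integral => u _; rewrite patchE /F indicE.
by case: (u \in D); rewrite ?mulr0.
Qed.

Let mFC : measurable_fun [set: R * R] (fun z : R * R =>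
  (F z.2 * C (z.2 - z.1))%:E).
Proof.
apply/measurable_EFinP; apply: measurable_funM.
  exact: (measurableT_comp mF measurable_snd).
apply: (measurableT_comp mC) => //.
exact: measurable_funB.
Qed.

Let FC0 (z : R * R) : (0 <= (F z.2 * C (z.2 - z.1))%:E)%E.
Proof. by rewrite lee_fin mulr_ge0. Qed.

Let mH : measurable_fun [set: R] H.
Proof. exact: (measurable_fun_fubini_tonelli_F (m2 := mu) _ mFC FC0). Qed.

(** Convolution of two L^1 functions: Tonelli, then a reflection in the inner variable. *)
Let intH : (\int[mu]_v H v <= kappa%:E)%E.
Proof.
have -> : (\int[mu]_v H v = \int[mu]_u \int[mu]_v (F u * C (u - v))%:E)%E.
  exact: (fubini_tonelli (m1 := mu) (m2 := mu) _ mFC FC0).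
apply: (@le_trans _ _ (\int[mu]_u ((F u)%:E * kC%:E))%E).
  apply: ge0_le_integral => //=.
  - by move=> u _; apply: integral_ge0 => v _; exact: (FC0 (v, u)).
  - exact: (measurable_fun_fubini_tonelli_G (m1 := mu) _ mFC FC0).
  - by apply: emeasurable_funM => //; exact/measurable_EFinP.
  - move=> u _; under eq_integral do rewrite EFinM.
    rewrite ge0_integralZl//; last 3 first.
    + by apply/measurable_EFinP; apply: (measurableT_comp mC);
        exact: measurable_funB.
    + by move=> v _; rewrite lee_fin.
    + by rewrite lee_fin.
    apply: lee_wpmul2l; first by rewrite lee_fin.
    rewrite (@ge0_integral_reflect (EFin \o C) u)//.
    exact/measurable_EFinP.
rewrite ge0_integralZr//; last 3 first.
- exact/measurable_EFinP.
- by move=> u _; rewrite lee_fin.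
- by rewrite lee_fin ltW.
by rewrite EFinM; apply: lee_wpmul2r => //; rewrite lee_fin ltW.
Qed.

Let aeH : {ae mu, forall v, (H v < +oo)%E}.
Proof.
have : mu.-integrable setT H.
  apply/integrableP; split => //; under eq_integral => v _.
    rewrite gee0_abs; last by apply: integral_ge0 => u _; exact: (FC0 (v, u)).
    over.
  exact: le_lt_trans intH (ltry _).
move/(integrable_ae measurableT); apply: filterS => v /= /(_ I).
by rewrite ge0_fin_numE//; apply: integral_ge0 => u _; exact: (FC0 (v, u)).
Qed.

Let h v := fine (H v) + kappa.

Let H0 v : (0 <= H v)%E.
Proof. by apply: integral_ge0 => u _; exact: (FC0 (v, u)). Qed.

Let h0 v : 0 < h v.
Proof. by rewrite ltr_wpDl// fine_ge0. Qed.

Let mh : measurable_fun [set: R] h.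
Proof.
apply: measurable_funD => //.
exact: (measurableT_comp (fine_measurable measurableT)).
Qed.

(** The summand [kappa] of [h] has a finite integral only over a set of finite measure; hence the
    outer integral runs over [E], and [kE] enters the constant. *)
Let inth : (\int[mu]_(v in E) (h v)%:E <= (kappa * (1 + kE))%:E)%E.
Proof.
apply: (@le_trans _ _ (\int[mu]_(v in E) (H v + kappa%:E))%E).
  apply: ge0_le_integral => //.
  - by move=> v _; rewrite lee_fin ltW.
  - by apply/measurable_EFinP; exact: measurable_funTS.
  - by apply: emeasurable_funD => //; exact: measurable_funTS.
  - move=> v _; rewrite /h EFinD leeD2r//.
    by have := H0 v; case: (H v) => [r||]//= _; rewrite leey.
rewrite ge0_integralD//; last 2 first.
- exact: measurable_funTS.
- by move=> v _; rewrite lee_fin ltW.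
rewrite mulrDr mulr1 EFinD; apply: leeD.
  by apply: le_trans intH; exact: ge0_subset_integral.
rewrite (@integral_cst _ _ _ mu E mE kappa%:E) (EFinM kappa).
by apply: lee_wpmul2l; [rewrite lee_fin ltW|exact: intE].
Qed.

(* Young's inequality before integration: [B `^ beta * C `^ rho] is split into
   [(F * C) `^ e * F `^ (1 - rho) * C `^ (rho - e)], whose exponents sum to 1.
   Adding [kappa] to [H v] keeps the bound positive. *)
Lemma young_pointwise : {ae mu, forall v, (J v <=
  (Mb * Mc * (h v `^ e * MF `^ (1 - rho) * kC `^ (rho - e)))%:E)%E}.
Proof.
move: aeH; apply: ae_lebesgueS => v Hv.
have Hfin : H v = (fine (H v))%:E by rewrite fineK// ge0_fin_numE.
have mCv : measurable_fun D (fun u => C (u - v)).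
  apply: measurable_funTS; apply: (measurableT_comp mC).
  exact: measurable_shift.
have := @ge0_integral_hoelder3 _ _ _ mu D mD (fun u => F u * C (u - v)) F
  (fun u => C (u - v)) e (1 - rho) (rho - e) (h v) MF kC e0 rho10 rhoe0.
move=> hoel; rewrite EFinM.
have mFD : measurable_fun D F by exact: measurable_funTS.
have mFCD : measurable_fun D (fun u => F u * C (u - v)) by exact: measurable_funM.
apply: (@le_trans _ _ ((Mb * Mc)%:E * \int[mu]_(u in D)
    ((F u * C (u - v)) `^ e * F u `^ (1 - rho) * C (u - v) `^ (rho - e))%:E)%E);
      last first.
  apply: lee_wpmul2l; first by rewrite lee_fin mulr_ge0// ltW.
  apply: hoel => //.
  - by ring.
  - by move=> u; rewrite mulr_ge0.
  - apply: (@le_trans _ _ (H v)).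
      apply: ge0_subset_integral => //; last by move=> u _; exact: (FC0 (v, u)).
      apply/measurable_EFinP; apply: measurable_funM => //.
      by apply: (measurableT_comp mC); exact: measurable_shift.
    by rewrite Hfin lee_fin lerDl ltW.
  - apply: le_trans intC.
    rewrite -(@ge0_integral_shift _ (EFin \o C) v)//; last exact/measurable_EFinP.
    apply: ge0_subset_integral => //; last by move=> u _; rewrite lee_fin.
    by apply/measurable_EFinP; apply: (measurableT_comp mC);
      exact: measurable_shift.
have mhoel : measurable_fun D (fun u =>
    (F u * C (u - v)) `^ e * F u `^ (1 - rho) * C (u - v) `^ (rho - e)).
  by apply: measurable_funM; [apply: measurable_funM|];
    exact: measurable_fun_powR.
rewrite -ge0_integralZl//; last 3 first.
- exact/measurable_EFinP.
- by move=> u _; rewrite lee_fin !mulr_ge0// powR_ge0.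
- by rewrite lee_fin mulr_ge0// ltW.
apply: ae_ge0_le_integral => //.
- apply: measurable_funTS; apply/measurable_EFinP; apply: measurableT_comp => //.
  by apply: measurable_funM => //; apply: (measurableT_comp mc);
    exact: measurable_shift.
- by move=> u _; rewrite lee_fin !mulr_ge0// ?powR_ge0// ltW.
- by apply: measurable_funeM; exact/measurable_EFinP.
(* The bound on [c] fails only on a null set, and for the fixed [v] a translate of that set is still
   null. *)
have := ae_lebesgue_shift v cC; move: bB; apply: ae_lebesgueS2 => u /= bu cu Du.
rewrite lee_fin normrM.
apply: (le_trans (ler_pM (normr_ge0 _) (normr_ge0 _) bu cu)).
rewrite mulrACA ler_pM2l ?mulr_gt0// /F indicE mem_set//= mulr1.
rewrite powRM ?powR_ge0//.
rewrite [leRHS](_ : _ = (B u `^ theta) `^ e * (B u `^ theta) `^ (1 - rho) *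
  (C (u - v) `^ e * C (u - v) `^ (rho - e))); last by ring.
rewrite -!ge0_powRD// -powRrM.
rewrite (_ : e + (1 - rho) = beta'); last by rewrite /e /beta'; field.
by rewrite thetaM (addrC e) subrK.
Qed.

Lemma young_ae_lty : {ae mu, forall v, (J v < +oo)%E}.
Proof.
by have := young_pointwise; apply: ae_lebesgueS => v /le_lt_trans; apply;
  rewrite ltry.
Qed.

Lemma young_measurable : measurable_fun [set: R] J.
Proof.
pose g (z : R * R) := (`|b z.2 * c (z.2 - z.1)| * \1_D z.2)%:E.
have mg : measurable_fun [set: R * R] g.
  apply/measurable_EFinP; apply: measurable_funM; last first.
    by apply: (measurableT_comp _ measurable_snd); exact: measurable_indic.
  apply: measurableT_comp => //; apply: measurable_funM.
    exact: (measurableT_comp mb measurable_snd).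
  by apply: (measurableT_comp mc); exact: measurable_funB.
have g0 z : (0 <= g z)%E by rewrite lee_fin mulr_ge0.
have := measurable_fun_fubini_tonelli_F (m2 := mu) _ mg g0.
congr (measurable_fun _ _); apply/funext => v; rewrite /J integral_mkcond.
apply: eq_integral => u _; rewrite patchE /g indicE.
by case: ifPn => _; rewrite ?mulr1// mulr0.
Qed.

(** The square of the pointwise bound is integrated against the square of [a]. As 2 alpha + 2 e = 1,
    Hoelder applies to [A] and [h], with a trivial third factor. The products stay in the extended
    reals because [J] may be infinite on a null set. *)
Lemma young_integral :
  (\int[mu]_(v in E) ((a v ^+ 2)%:E * (J v * J v)) <=
   (young_const * (t - s) `^ (2 * lambda))%:E)%E.
Proof.
have J0 v : (0 <= J v)%E by apply: integral_ge0 => u _; rewrite lee_fin.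
have hoel := @ge0_integral_hoelder3 _ _ _ mu E mE A h (cst 0) (alpha + alpha)
  (e + e) 0
  kA (kappa * (1 + kE)) 1.
pose K := (Ma * Mb * Mc) ^+ 2 * (MF `^ (1 - rho)) ^+ 2 * (kC `^ (rho - e)) ^+ 2.
have K0 : 0 <= K by do 2 (apply: mulr_ge0; last exact: sqr_ge0); exact: sqr_ge0.
have mhoel : measurable_fun E (fun v => A v `^ (alpha + alpha) * h v `^
  (e + e) * cst 0 v `^ 0).
  by apply: measurable_funTS; apply: measurable_funM; [apply: measurable_funM|];
    exact: measurable_fun_powR.
apply: (@le_trans _ _ (K%:E * \int[mu]_(v in E)
   (A v `^ (alpha + alpha) * h v `^ (e + e) * cst 0 v `^ 0)%:E)%E); last first.
  apply: (@le_trans _ _ (K%:E * (kA `^ (alpha + alpha) * (kappa * (1 + kE)) `^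
    (e + e) * 1 `^ 0)%:E)%E).
    apply: lee_wpmul2l => //; apply: hoel => //.
    - exact: addr_ge0.
    - exact: addr_ge0.
    - by rewrite /e; field.
    - by rewrite mulr_gt0// addr_gt0.
    - exact: measurable_funTS.
    - exact: measurable_funTS.
    - by move=> v; rewrite ltW.
    - apply: le_trans intA; apply: ge0_subset_integral => //.
      + exact/measurable_EFinP.
      + by move=> x _; rewrite lee_fin.
    - by rewrite integral0 lee_fin.
  rewrite -EFinM lee_fin le_eqVlt; apply/orP; left; apply/eqP.
  rewrite /K /young_const /kappa powRr0 mulr1 -[MF * kC * _]mulrA.
  rewrite (powRM (e + e)) ?(ltW MF0)//; last by rewrite mulr_ge0// ?addr_ge0//
    ltW.
  (* All dependence on t - s sits in [MF]; its total exponent 2 (1 - rho) + 2 e equals 2 beta', and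
     beta' (1 - theta) = lambda. *)
  have MFE : (MF `^ (1 - rho)) ^+ 2 * MF `^ (e + e) =
      kB `^ (2 * beta) * (t - s) `^ (2 * lambda).
    have -> : (MF `^ (1 - rho)) ^+ 2 * MF `^ (e + e) = MF `^ (2 * beta').
      rewrite expr2 -(@ge0_powRD _ MF (1 - rho) (1 - rho))//.
      rewrite -(@ge0_powRD _ MF); [congr powR|exact: addr_ge0|exact: addr_ge0].
      by rewrite /e /beta'; field.
    rewrite /MF powRM ?powR_ge0// -!powRrM.
    rewrite mulrCA thetaM; congr (_ * (_ `^ _)).
    by rewrite mulrCA mulrBl mul1r thetaM /beta' /lambda; ring.
  set X := kB `^ (2 * beta) in MFE *.
  set Y := (t - s) `^ _ in MFE *.
  set Z := _ `^ (alpha + alpha); set U := (kC * _) `^ _.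
  transitivity ((Ma * Mb * Mc) ^+ 2 * (kC `^ (rho - e)) ^+ 2 * Z * U *
    ((MF `^ (1 - rho)) ^+ 2 * MF `^ (e + e))); first by ring.
  by rewrite MFE; ring.
rewrite -ge0_integralZl//; last 2 first.
- exact/measurable_EFinP.
- by move=> v _; rewrite lee_fin !mulr_ge0// powR_ge0.
apply: ae_ge0_le_integral => //.
- by move=> v _; rewrite !mule_ge0// lee_fin sqr_ge0.
- apply: measurable_funTS; apply: emeasurable_funM.
    by apply/measurable_EFinP; exact: measurable_funX.
  by apply: emeasurable_funM; exact: young_measurable.
- by move=> v _; rewrite mule_ge0// lee_fin// !mulr_ge0// powR_ge0.
- by apply: measurable_funeM; exact/measurable_EFinP.
have := young_pointwise; move: aA; apply: ae_lebesgueS2 => v av Jv Ev.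
set j := (X in X%:E) in Jv.
have j0 : 0 <= j by rewrite !mulr_ge0 ?powR_ge0// ltW.
apply: (@le_trans _ _ (((Ma * A v `^ alpha) ^+ 2)%:E * (j%:E * j%:E))%E).
  apply: lee_pmul.
  - by rewrite lee_fin sqr_ge0.
  - by rewrite mule_ge0.
  - by rewrite lee_fin -[leLHS]real_normK ?num_real// lerXn2r// nnegrE mulr_ge0
      ?powR_ge0// ltW.
  - by apply: lee_pmul.
rewrite -!EFinM lee_fin /= powRr0 mulr1 (@ge0_powRD _ (A v))// (@ge0_powRD _
  (h v) e e)// le_eqVlt; apply/orP; left; apply/eqP.
by rewrite /j /K; ring.
Qed.

End young_interval.
End young_estimate.

(** * The Volterra kernel *)

Lemma inve_ge (R : realType) (p : \bar R) (k : R) : 0 < k -> (k%:E <= p)%E ->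
  [/\ (p^-1 = (fine p^-1)%:E)%E, 0 <= fine (p^-1)%E & fine (p^-1)%E <= k^-1].
Proof.
move=> k0; case: p => [p||//]; last first.
  by move=> _; rewrite /= invr_ge0 (ltW k0).
rewrite lee_fin => kp; have p0 : 0 < p by exact: lt_le_trans kp.
rewrite inver gt_eqF//=; split => //; first by rewrite invr_ge0 ltW.
by rewrite lef_pV2// posrE.
Qed.

Section volterra_kernel_estimate.
Context {R : realType}.
Notation mu := (@lebesgue_measure R).
Variables (T : R) (p q r : \bar R) (a b c : R -> R).
Hypotheses (hT : 0 < T) (hp : (2%:E <= p)%E) (hq : (1%:E < q)%E)
  (hr : (1%:E <= r)%E) (hpr : ((1 / 2)%:E <= p^-1 + r^-1)%E)
  (hpqr : (p^-1 + q^-1 + r^-1 < (3 / 2)%:E)%E)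
  (ha : Lp_on `[0, T] p a) (hb : Lp_on `[0, T] q b) (hc : Lp_on `[0, T] r c).

Let lambda := 3 / 2 - fine (p^-1)%E - fine (q^-1)%E - fine (r^-1)%E.
Let a' : R -> R := a \_ `[0, T].
Let b' : R -> R := b \_ `[0, T].
Let c' : R -> R := c \_ `[0, T].
Let E : set R := `[0, T].
Let J (s t v : R) : \bar R := (\int[mu]_(u in `[s, t]) `|b' u * c' (u - v)|%:E)%E.

Lemma young_Lp : exists K : R, 0 < K /\ forall s t, s < t ->
  [/\ measurable_fun [set: R] (J s t), {ae mu, forall v, (J s t v < +oo)%E} &
      (\int[mu]_(v in E) ((a' v ^+ 2)%:E * (J s t v * J s t v)) <=
       (K * (t - s) `^ (2 * lambda))%:E)%E].
Proof.
have [pE p0 p2] := inve_ge (ltr0n _ 2 : 0 < 2 :> R) hp.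
have [qE q0 q2] := inve_ge ltr01 (ltW hq).
have [rE r0 r2] := inve_ge ltr01 hr.
have p1 : (1 <= p)%E by apply: le_trans hp; rewrite lee_fin ler1n.
move: hpr hpqr; rewrite pE qE rE -!EFinD lee_fin lte_fin => hpr' hpqr'.
have [Ma [A [Ma0 mA A0 iA aA]]] := Lp_on_powR_le p1 ha.
have [Mb [B [Mb0 mB B0 iB bB]]] := Lp_on_powR_le (ltW hq) hb.
have [Mc [C [Mc0 mC C0 iC cC]]] := Lp_on_powR_le hr hc.
have bnd (F : R -> R) : (forall x, 0 <= F x) -> (\int[mu]_x (F x)%:E < +oo)%E ->
    exists k : R, 0 < k /\ (\int[mu]_x (F x)%:E <= k%:E)%E.
  (* Adding 1 makes the bound positive even when the function vanishes almost everywhere. *)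
  move=> F0 iF; exists (fine (\int[mu]_x (F x)%:E)%E + 1); split.
    by rewrite ltr_wpDl// fine_ge0// integral_ge0// => x _; rewrite lee_fin.
  rewrite EFinD fineK; first by rewrite leeDl.
  by rewrite ge0_fin_numE// integral_ge0// => x _; rewrite lee_fin.
have [kA [kA0 iA']] := bnd A A0 iA.
have [kB [kB0 iB']] := bnd B B0 iB.
have [kC [kC0 iC']] := bnd C C0 iC.
pose K := young_const (fine p^-1)%E (fine q^-1)%E
  (fine r^-1)%E Ma Mb Mc kA kB kC T.
have mE : measurable E by exact: measurable_itv.
have muE : (mu E <= T%:E)%E.
  by rewrite lebesgue_measure_itv/= lte_fin hT oppr0 adde0.
have p2' : fine (p^-1)%E <= 1 / 2 by rewrite mul1r.
rewrite invr1 in r2.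
have ma := Lp_on_measurable ha.
have mb := Lp_on_measurable hb.
have mc := Lp_on_measurable hc.
have K0 : 0 <= K.
  rewrite /K /young_const !mulr_ge0// ?sqr_ge0// ?powR_ge0//; exact: ltW.
exists (K + 1); split; first by rewrite ltr_wpDl.
move=> s t st; split.
- exact: young_measurable.
- exact: (young_ae_lty p2' q0 r2 hpr' hpqr' mb mc mB mC B0 C0 Mb0 Mc0 kB0 kC0
    iB' iC' bB cC st).
- apply: (le_trans (young_integral mE p0 p2' q0 r2 hpr' hpqr' ma mb mc mA mB mC
    A0 B0 C0 Ma0 Mb0 Mc0 kA0 kB0 kC0 hT iA' iB' iC' muE aA bB cC st)).
  by rewrite lee_fin ler_wpM2r ?powR_ge0// lerDl.
Qed.


Let mb' : measurable_fun [set: R] b'. Proof. exact: Lp_on_measurable hb. Qed.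
Let mc' : measurable_fun [set: R] c'. Proof. exact: Lp_on_measurable hc. Qed.
Let ma' : measurable_fun [set: R] a'. Proof. exact: Lp_on_measurable ha. Qed.

Let g (u v : R) := b' u * c' (u - v).
Let G (t v : R) := \int[mu]_(u in `[0, t]) g u v.

Let mg v : measurable_fun [set: R] (g ^~ v).
Proof.
apply: measurable_funM => //; apply: (measurableT_comp mc').
exact: measurable_shift.
Qed.

Let mEg v : measurable_fun [set: R] (EFin \o (g ^~ v)).
Proof. by apply/measurable_EFinP; exact: mg. Qed.

Let mabsg v : measurable_fun [set: R] (abse \o (EFin \o (g ^~ v))).
Proof. by apply: measurableT_comp => //; exact: mEg. Qed.

Let c'_lt0 x : x < 0 -> c' x = 0.
Proof.
move=> x0; rewrite /c' patchE memNset//=.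
by rewrite in_itv/= => /andP[]; rewrite leNgt x0.
Qed.

Let conv_integrandE (t v u : R) : 0 <= t -> t <= T -> 0 <= v -> v <= u ->
  u <= t ->
  conv_integrand b c v u = g u v.
Proof.
move=> t0 tT v0 vu ut; rewrite /conv_integrand /g /b' /c' !patchE !mem_set//=.
  by rewrite in_itv/=; apply/andP; split; lra.
by rewrite in_itv/=; apply/andP; split; lra.
Qed.

(** The zero extensions absorb every cut-off: for u < v the factor [c'] vanishes, so [v, t] can be
    replaced by [0, t]; for t < v <= T this happens for all u <= t, so that [G t v = 0]; outside
    [0, T] the factor [a'] vanishes. *)
Lemma volterra_patchE (t v : R) : 0 <= t -> t <= T ->
  (volterra_kernel a b c t \_ `[0, t]) v = a' v * G t v.
Proof.
move=> t0 tT; rewrite patchE /a' patchE.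
have [/set_mem/=|/negP] := boolP (v \in (`[0, t]%classic : set R)).
  rewrite in_itv/= => /andP[v0 vt]; rewrite mem_set/=; last first.
    by rewrite in_itv/= v0 (le_trans vt).
  congr (_ * _); rewrite Rintegral_mkcond /G [RHS]Rintegral_mkcond.
  apply: eq_Rintegral => u _; rewrite !patchE.
  have [ut|ut] := leP u t; last first.
    rewrite memNset/=; last by rewrite in_itv/= => /andP[_]; rewrite leNgt ut.
    by rewrite memNset//= in_itv/= => /andP[_]; rewrite leNgt ut.
  have [vu|uv] := leP v u.
    rewrite !mem_set/= ?in_itv/= ?vu ?ut ?(le_trans v0 vu)//.
    exact: conv_integrandE ut.
  rewrite memNset/=; last by rewrite in_itv/= leNgt uv.
  by case: ifPn => // _; rewrite /g (c'_lt0 (x := u - v)) ?subr_lt0// mulr0.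
move=> vt; case: ifPn => [/set_mem/=|_]; last by rewrite mul0r.
rewrite in_itv/= => /andP[v0 vT]; have tv : t < v.
  by rewrite ltNge; apply/negP => vt'; apply: vt; rewrite inE/= in_itv/= v0 vt'.
rewrite /G (_ : \int[mu]_(u in `[0, t]) g u v = 0) ?mulr0//.
rewrite -[RHS](mul0r (fine (mu `[0, t]%classic))) -(Rintegral_cst _ _ 0)//.
apply: eq_Rintegral => u /set_mem/=; rewrite in_itv/= => /andP[_ ut].
by rewrite /g c'_lt0 ?mulr0// subr_lt0 (le_lt_trans ut).
Qed.

(** A single exceptional null set for all times: absolute convergence over [0, T] gives it over
    every subinterval. *)
Let good v := (J 0 T v < +oo)%E.

Let g_integrable (D : set R) v : measurable D -> D `<=` E -> good v ->
  mu.-integrable D (EFin \o (g ^~ v)).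
Proof.
move=> mD DE gv; apply/integrableP; split.
  exact: measurable_funTS (mEg v).
apply: le_lt_trans gv; apply: ge0_subset_integral => //=.
exact: measurable_funTS (mabsg v).
Qed.

Let ae_good : {ae mu, forall v, good v}.
Proof. by have [K [_ /(_ 0 T hT)[]]] := young_Lp. Qed.

Let mG t : measurable_fun [set: R] (G t).
Proof.
pose f (z : R * R) := (g z.2 z.1 * \1_(`[0, t]%classic : set R) z.2)%:E.
have mf : measurable_fun [set: R * R] f.
  apply/measurable_EFinP; apply: measurable_funM; last first.
    by apply: (measurableT_comp _ measurable_snd); exact: measurable_indic.
  apply: measurable_funM; first exact: (measurableT_comp mb' measurable_snd).
  by apply: (measurableT_comp mc'); exact: measurable_funB.
have -> : G t = fun v => fine (\int[mu]_u f (v, u))%E.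
  apply/funext => v; rewrite /G Rintegral_mkcond; congr fine.
  apply: eq_integral => u _; rewrite patchE /f/= indicE.
  by case: ifPn => _; rewrite ?mulr1// mulr0.
apply: (measurableT_comp (fine_measurable measurableT)).
(* The inner integral may diverge for a null set of [v], so the positive and negative parts are
   handled separately by Tonelli. *)
under eq_fun do rewrite integralE.
apply: emeasurable_funB.
- have mfpos : measurable_fun [set: R * R] (f^\+)%E by exact: measurable_funepos.
  have fpos0 z : (0 <= (f^\+)%E z)%E by exact: funepos_ge0.
  have := measurable_fun_fubini_tonelli_F (m2 := mu) _ mfpos fpos0.
  by congr (measurable_fun _ _); apply/funext => x; apply: eq_integral => u _;
    rewrite !funeposE.
- have mfneg : measurable_fun [set: R * R] (f^\-)%E by exact: measurable_funeneg.
  have fneg0 z : (0 <= (f^\-)%E z)%E by exact: funeneg_ge0.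
  have := measurable_fun_fubini_tonelli_F (m2 := mu) _ mfneg fneg0.
  by congr (measurable_fun _ _); apply/funext => x; apply: eq_integral => u _;
    rewrite !funenegE.
Qed.

Let maG t : measurable_fun [set: R] (fun v => a' v * G t v).
Proof. by apply: measurable_funM => //; exact: mG. Qed.

Let GB (s t v : R) : 0 <= s -> s < t -> t <= T -> good v ->
  (`|G t v - G s v|%:E <= J s t v)%E.
Proof.
move=> s0 st tT gv; rewrite /G Rintegral_itvB; last 3 first.
- by apply: g_integrable => //; apply: subset_itvl; rewrite bnd_simp.
- by rewrite bnd_simp.
- by rewrite bnd_simp ltW.
rewrite EFin_normr_Rintegral//; last first.
  apply: g_integrable => // u /=; rewrite in_itv/= => /andP[su ut].
  by rewrite /E/= in_itv/= (le_trans s0 (ltW su)) (le_trans ut tT).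
apply: le_trans (le_abse_integral _ _ _) _ => //.
  exact: measurable_funTS (mEg v).
apply: ge0_subset_integral => //=.
- exact: measurable_funTS (mabsg v).
- by apply: subset_itvr; rewrite bnd_simp.
Qed.

Let G_le (t v : R) : 0 <= t -> t <= T -> good v -> (`|G t v|%:E <= J 0 T v)%E.
Proof.
move=> t0 tT gv; have stE : `[0, t]%classic `<=` E by apply: subset_itvl;
  rewrite bnd_simp.
rewrite /G EFin_normr_Rintegral//; last exact: g_integrable.
apply: le_trans (le_abse_integral _ _ _) _ => //.
  exact: measurable_funTS (mEg v).
apply: ge0_subset_integral => //=.
exact: measurable_funTS (mabsg v).
Qed.

Let sqr_le (x y : R) (z : \bar R) : (`|y|%:E <= z)%E ->
  (((x * y) ^+ 2)%:E <= (x ^+ 2)%:E * (z * z))%E.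
Proof.
move=> yz; rewrite exprMn EFinM lee_wpmul2l// ?lee_fin ?sqr_ge0//.
rewrite -(real_normK (num_real y)) expr2 EFinM.
by apply: lee_pmul; rewrite ?lee_fin.
Qed.

(** Both claims come from the estimate on the full interval: [J 0 T] is finite almost everywhere and
    dominates every [G t], and its product with [a'] is square integrable. *)
Lemma volterra_kernel_well_defined : volterra_well_defined T a b c.
Proof.
move=> t; rewrite in_itv/= => /andP[t0 tT]; split.
  move: ae_good; apply: ae_lebesgueS => v gv; rewrite in_itv/= => /andP[v0 vt].
  have vtE : `[v, t]%classic `<=` E.
    by move=> u /=; rewrite in_itv/= => /andP[vu ut];
      rewrite /E/= in_itv/= (le_trans v0 vu) (le_trans ut tT).
  apply: eq_integrable (g_integrable _ vtE gv) => // u /set_mem/=.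
  by rewrite in_itv/= => /andP[vu ut]; rewrite /=
    (conv_integrandE t0 tT v0 vu ut).
have kE : volterra_kernel a b c t \_ `[0, t] = (fun v => a' v * G t v).
  by apply/funext => v; rewrite volterra_patchE.
rewrite /Lp_on kE inE; apply/andP; split; rewrite inE/=.
  exact: maG.
rewrite /finite_norm unlock; apply: poweR_lty.
have [K [K0 /(_ 0 T hT)[mJ aJ iJ]]] := young_Lp.
apply: le_lt_trans (ltry (K * (T - 0) `^ (2 * lambda))).
apply: le_trans iJ; rewrite [leRHS]integral_mkcond.
have a'J0 v : (0 <= (a' v ^+ 2)%:E * (J 0 T v * J 0 T v))%E.
  have J0 : (0 <= J 0 T v)%E by apply: integral_ge0 => u _; rewrite lee_fin.
  by rewrite !mule_ge0// lee_fin sqr_ge0.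
have mE : measurable E by exact: measurable_itv.
apply: ae_ge0_le_integral => //.
- by move=> v _; rewrite poweR_ge0.
- apply: (@measurableT_comp _ _ _ _ _ _ (fun x => x `^ 2)%E) => //=.
    exact: measurable_poweR.
  by apply/measurable_EFinP; apply: (measurableT_comp _ (maG t)).
- by move=> v _; rewrite patchE; case: ifPn.
- apply/(measurable_restrictT _ mE)/measurable_funTS.
  apply: emeasurable_funM; last by exact: emeasurable_funM.
  by apply/measurable_EFinP; exact: measurable_funX.
move: ae_good; apply: ae_lebesgueS => v gv _; rewrite /= powR_mulrn//.
rewrite real_normK ?num_real// patchE; case: ifPn => [_|vE].
  exact/sqr_le/G_le.
by rewrite /a' patchE (negbTE vE) mul0r expr0n.
Qed.

Lemma volterra_kernel_increment : exists K : R, 0 < K /\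
  forall s t : R, 0 <= s -> s < t -> t <= T ->
  (\int[mu]_(v in E) (((volterra_kernel a b c t \_ `[0, t]) v -
     (volterra_kernel a b c s \_ `[0, s]) v) ^+ 2)%:E <=
   (K * (t - s) `^ (2 * lambda))%:E)%E.
Proof.
have [K [K0 HK]] := young_Lp; exists K; split => // s t s0 st tT.
have [mJ aJ iJ] := HK s t st.
apply: le_trans iJ.
have J0 v : (0 <= J s t v)%E by apply: integral_ge0 => u _; rewrite lee_fin.
have mE : measurable E by exact: measurable_itv.
have kE u v : 0 <= u -> u <= T -> (volterra_kernel a b c u \_ `[0, u]) v = a' v
  * G u v.
  exact: volterra_patchE.
under eq_integral => v _.
  rewrite !kE ?(ltW (le_lt_trans s0 st)) ?(ltW (lt_le_trans st tT))// -mulrBr.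
  over.
apply: ae_ge0_le_integral => //.
- by move=> v _; rewrite lee_fin sqr_ge0.
- apply: measurable_funTS; apply/measurable_EFinP; apply: measurable_funX.
  by apply: measurable_funM; [exact: ma'|apply: measurable_funB; exact: mG].
- by move=> v _; rewrite !mule_ge0// lee_fin sqr_ge0.
- apply: measurable_funTS; apply: emeasurable_funM;
    last by exact: emeasurable_funM.
  by apply/measurable_EFinP; exact: measurable_funX.
move: ae_good; apply: ae_lebesgueS => v gv _.
exact/sqr_le/GB.
Qed.

End volterra_kernel_estimate.

(** * Independence and Gaussian exponential moments *)

Section integral_transfer.
Import HBNNSimple.
Local Open Scope ereal_scope.

(** The weight [G] plays two roles later: a density with respect to Lebesgue measure, and the
    product of the remaining factors of an independent family. *)
Let weighted_integral_sfun d (T : measurableType d) (R : realType)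
    (mu : {measure set T -> \bar R}) (G : T -> R) (X : T -> R)
    (h : {nnsfun R >-> R}) :
  measurable_fun [set: T] G -> (forall w, 0 <= G w)%R ->
  measurable_fun [set: T] X ->
  \int[mu]_w (G w * h (X w))%:E =
  \sum_(k \in range h) k%:E * \int[mu]_w (G w * \1_(h @^-1` [set k]) (X w))%:E.
Proof.
move=> mG G0 mX.
have mGI k : measurable_fun [set: T] (fun w => (G w * \1_(h @^-1` [set k])
  (X w))%:E).
  apply/measurable_EFinP; apply: measurable_funM => //.
  exact: (measurableT_comp (f := \1_(h @^-1` [set k]) : R -> R)).
have GI0 k w : 0 <= (G w * \1_(h @^-1` [set k]) (X w))%:E.
  by rewrite lee_fin mulr_ge0.
transitivity (\sum_(k \in range h)
    \int[mu]_w (k%:E * (G w * \1_(h @^-1` [set k]) (X w))%:E)); last first.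
  apply: eq_fsbigr => k /set_mem[x _ <-].
  by rewrite ge0_integralZl// lee_fin.
rewrite -ge0_integral_fsum//; last 2 first.
- by move=> k; exact: measurable_funeM.
(* A negative [k] is not a value of [h], so its term is 0. *)
- move=> k w _; have [k0|k0] := leP 0%R k; first by rewrite mule_ge0.
  by rewrite preimage_nnfun0// indic0 mulr0 mule0.
apply: eq_integral => w _; rewrite fimfunE EFinM -fsumEFin//.
rewrite ge0_mule_fsumr; last first.
  by move=> k; rewrite EFinM nnfun_muleindic_ge0.
by apply: eq_fsbigr => k _; rewrite -!EFinM; congr EFin; rewrite mulrCA.
Qed.

Let weighted_integral_cvg d (T : measurableType d) (R : realType)
    (mu : {measure set T -> \bar R}) (G : T -> R) (X : T -> R)
    (f : R -> R) (mf : measurable_fun [set: R] (EFin \o f)) :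
  (forall x, 0 <= f x)%R ->
  measurable_fun [set: T] G -> (forall w, 0 <= G w)%R ->
  measurable_fun [set: T] X ->
  \int[mu]_w (G w * nnsfun_approx measurableT mf n (X w))%:E @[n --> \oo] -->
  \int[mu]_w (G w * f (X w))%:E.
Proof.
move=> f0 mG G0 mX; set f_ := nnsfun_approx _ _.
have mGf n : measurable_fun [set: T] (fun w => (G w * f_ n (X w))%:E).
  apply/measurable_EFinP; apply: measurable_funM => //.
  exact: (measurableT_comp (measurable_funP (f_ n))).
have -> : \int[mu]_w (G w * f (X w))%:E =
    \int[mu]_w limn (fun n => (G w * f_ n (X w))%:E).
  apply: eq_integral => w _; apply/esym/cvg_lim => //; rewrite EFinM.
  under eq_fun do rewrite EFinM.
  by apply: cvgeZl => //; apply: cvg_nnsfun_approx => // x _; rewrite lee_fin.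
apply: cvg_monotone_convergence => //.
- by move=> n w _; rewrite lee_fin mulr_ge0.
- move=> w _ m n mn; rewrite lee_fin ler_wpM2l//.
  exact/lefP/nd_nnsfun_approx.
Qed.

(* Both sides are integrals of [f] against measures on the line that agree on
   every measurable set. *)
Lemma eq_weighted_integral d1 (T1 : measurableType d1) d2 (T2 : measurableType d2)
    (R : realType) (mu1 : {measure set T1 -> \bar R}) (mu2 : {measure set T2 ->
      \bar R})
    (G1 : T1 -> R) (G2 : T2 -> R) (X1 : T1 -> R) (X2 : T2 -> R) (f : R -> R) :
  measurable_fun [set: T1] G1 -> (forall w, 0 <= G1 w)%R ->
    measurable_fun [set: T1] X1 ->
  measurable_fun [set: T2] G2 -> (forall w, 0 <= G2 w)%R ->
    measurable_fun [set: T2] X2 ->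
  (forall A : set R, measurable A ->
    \int[mu1]_w (G1 w * \1_A (X1 w))%:E = \int[mu2]_w (G2 w * \1_A (X2 w))%:E) ->
  measurable_fun [set: R] f -> (forall x, 0 <= f x)%R ->
  \int[mu1]_w (G1 w * f (X1 w))%:E = \int[mu2]_w (G2 w * f (X2 w))%:E.
Proof.
move=> mG1 G10 mX1 mG2 G20 mX2 eqA mf f0.
have mf' : measurable_fun [set: R] (EFin \o f) by exact/measurable_EFinP.
have c1 := weighted_integral_cvg (mu := mu1) mf' f0 mG1 G10 mX1.
have c2 := weighted_integral_cvg (mu := mu2) mf' f0 mG2 G20 mX2.
suff E : (fun n => \int[mu1]_w (G1 w * nnsfun_approx measurableT mf' n
  (X1 w))%:E) =
    (fun n => \int[mu2]_w (G2 w * nnsfun_approx measurableT mf' n (X2 w))%:E).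
  by rewrite E in c1; exact: (cvg_unique _ c1 c2).
apply/funext => n; rewrite !weighted_integral_sfun//.
by apply: eq_fsbigr => k _; congr (_ * _); exact: eqA.
Qed.

End integral_transfer.

(** * Expectations of products of independent variables *)

Section independent_product.
Context d (T : measurableType d) (R : realType) (P : probability T R).
Variables (n : nat) (D : nat -> T -> R).
Hypothesis mD : forall i, measurable_fun [set: T] (D i).
Hypothesis indepD : forall A : nat -> set R, (forall i, measurable (A i)) ->
  P (\bigcap_(i < n) [set w | A i (D i w)]) = (\prod_(i < n) P [set w | A i
    (D i w)])%E.

Let mDA i (A : set R) : measurable A -> measurable [set w | A (D i w)].
Proof. by move=> mA; rewrite -[X in measurable X]setTI; exact: mD. Qed.

Let mfD (f : nat -> R -> R) i : (forall i, measurable_fun [set: R] (f i)) ->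
  measurable_fun [set: T] (fun w => f i (D i w)).
Proof. by move=> mf; exact: measurableT_comp. Qed.

Let integral_indicD i (A : set R) : measurable A ->
  (\int[P]_w (\1_A (D i w))%:E = P [set w | A (D i w)])%E.
Proof.
move=> mA; transitivity (\int[P]_w (\1_[set w | A (D i w)] w)%:E)%E.
  by apply: eq_integral => w _; rewrite !indicE.
by rewrite integral_indic ?setIT//; exact: mDA.
Qed.

(* Induction on the number [k] of coordinates that carry an arbitrary function
   instead of an indicator. *)
Let integral_prod_rec k (f : nat -> R -> R) (m : nat -> R) :
  (forall i, measurable_fun [set: R] (f i)) -> (forall i x, 0 <= f i x) ->
  (forall i, (i < n)%N -> \int[P]_w (f i (D i w))%:E = (m i)%:E)%E ->
  (forall i, (k <= i < n)%N -> exists2 A, measurable A & f i = \1_A) ->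
  (\int[P]_w (\prod_(i < n) f i (D i w))%:E = (\prod_(i < n) m i)%:E)%E.
Proof.
elim: k f m => [|k IH] f m mf f0 fm fA.
  (* Beyond [n] the empty set is a dummy, since [indepD] asks for a measurable set at every
     index. *)
  have {}fA i : {A | measurable A & (i < n)%N -> f i = \1_A}.
    apply: cid2; have [ni|ni] := ltnP i n; last by exists set0.
    by have [A mA fiA] := fA i ni; exists A.
  pose A i := s2val (fA i).
  have mA i : measurable (A i) by exact: s2valP (fA i).
  have fE i : (i < n)%N -> f i = \1_(A i) by exact: s2valP' (fA i).
  transitivity (\int[P]_w (\1_(\bigcap_(i < n) [set w | A i (D i w)]) w)%:E)%E.
    apply: eq_integral => w _; congr EFin.
    have [wA|wA] := pselect ((\bigcap_(i < n) [set w | A i (D i w)]) w).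
      rewrite indicE mem_set// big1// => i _.
      by rewrite fE ?ltn_ord// indicE mem_set//; exact: (wA i (ltn_ord i)).
    rewrite indicE memNset//.
    have [i [ni iA]] : exists i, (i < n)%N /\ ~ A i (D i w).
      apply: contrapT => /forallNP h; apply: wA => i /= ni.
      by have := h i; rewrite not_andE => -[//|/contrapT].
    rewrite (bigD1 (Ordinal ni))//= fE// indicE memNset//= mul0r//.
  rewrite integral_indic//; last first.
    by apply: bigcap_measurableType => i _; exact: mDA.
  rewrite setIT; apply: (eq_trans (indepD mA)); rewrite -prodEFin.
  apply: eq_bigr => i _.
  rewrite -fm ?ltn_ord// fE ?ltn_ord//.
  exact/esym/integral_indicD.
have [nk|kn] := leqP n k.
  by apply: IH => // i /andP[ki ni]; have := leq_trans ni (leq_trans nk ki);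
    rewrite ltnn.
pose k' := Ordinal kn.
rewrite (bigD1 k')//= mulrC EFinM.
under eq_integral do rewrite (bigD1 k')//= mulrC.
have mG : measurable_fun [set: T] (fun w => \prod_(i < n | i != k') f i (D i w)).
  rewrite (_ : (fun _ => _) = fun w =>
    \prod_(i <- index_enum 'I_n) if i != k' then f i (D i w) else 1); last first.
    by apply/funext => w; rewrite big_mkcond.
  apply: measurable_prod => i _; case: (i != k'); last exact: measurable_cst.
  exact: mfD.
have G0 w : 0 <= \prod_(i < n | i != k') f i (D i w) by exact: prodr_ge0.
pose c := \prod_(i < n | i != k') m i.
have c0 : 0 <= c.
  apply: prodr_ge0 => i _; rewrite -lee_fin -fm ?ltn_ord//.
  by apply: integral_ge0 => w _; rewrite lee_fin.
(* The other factors are the weight on the left, and their expected product [c] is the constant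
   weight on the right. It then suffices to compare the two sides for indicators of the [k]-th
   coordinate. *)
rewrite (@eq_weighted_integral _ _ _ _ _ P P _ (cst c) (D k) (D k))//=.
  under eq_integral do rewrite EFinM.
  rewrite ge0_integralZl//; last 2 first.
  - by apply/measurable_EFinP; exact: mfD.
  - by move=> w _; rewrite lee_fin.
  by rewrite fm.
move=> A mA.
(* An indicator in place of [f k] leaves only [k] arbitrary coordinates, as the induction hypothesis
   requires. *)
pose f' i := if i == k then \1_A : R -> R else f i.
pose m' i := if i == k then fine (P [set w | A (D k w)]) else m i.
have PA : (\int[P]_w (\1_A (D k w))%:E = (fine (P [set w | A (D k w)]))%:E)%E.
  rewrite fineK; last exact: fin_num_measure (mDA k mA).
  exact: integral_indicD.
transitivity (\int[P]_w (\prod_(i < n) f' i (D i w))%:E)%E.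
  apply: eq_integral => w _; rewrite [in RHS](bigD1 k')//= [in RHS]mulrC /f'
    eqxx; congr (_ * _)%:E.
  by apply: eq_bigr => i; rewrite -val_eqE/= => /negbTE ->.
rewrite (IH f' m').
- rewrite (bigD1 k')//= mulrC /m' eqxx.
  under [in RHS]eq_integral do rewrite EFinM.
  rewrite ge0_integralZl//; last first.
    by apply/measurable_EFinP; exact: (measurableT_comp (f := \1_A : R -> R)).
  rewrite PA -EFinM; congr (_ * _)%:E.
  by apply: eq_bigr => i; rewrite -val_eqE/= => /negbTE ->.
- by move=> i; rewrite /f'; case: eqP.
- by move=> i x; rewrite /f'; case: eqP.
- by move=> i ni; rewrite /f' /m'; case: eqP => [->|_]; [exact: PA|exact: fm].
- move=> i /andP[ki ni]; rewrite /f'; case: eqP => [_|ik]; first by exists A.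
  by apply: fA; rewrite ni andbT ltn_neqAle ki andbT eq_sym; exact/eqP.
Qed.

Lemma integral_prod_independent (f : nat -> R -> R) (m : nat -> R) :
  (forall i, measurable_fun [set: R] (f i)) -> (forall i x, 0 <= f i x) ->
  (forall i, (i < n)%N -> \int[P]_w (f i (D i w))%:E = (m i)%:E)%E ->
  (\int[P]_w (\prod_(i < n) f i (D i w))%:E = (\prod_(i < n) m i)%:E)%E.
Proof.
move=> mf f0 fm; apply: (@integral_prod_rec n) => // i /andP[ni].
by rewrite ltnNge ni.
Qed.

End independent_product.

Lemma normal_expR (R : realType) (s y : R) : s != 0 ->
  (\int[normal_prob 0 s]_x (expR (y * x))%:E = (expR (y ^+ 2 * s ^+ 2 / 2))%:E)%E.
Proof.
move=> s0; pose mu := @lebesgue_measure R.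
have mexp : measurable_fun [set: R] (fun x => expR (y * x)).
  by apply: measurableT_comp => //; exact: measurable_funM.
transitivity (\int[normal_prob 0 s]_x (cst 1 x * expR (y * x))%:E)%E.
  by apply: eq_integral => x _; rewrite mul1r.
transitivity (\int[mu]_x (normal_pdf 0 s x * expR (y * x))%:E)%E.
  apply: (@eq_weighted_integral _ _ _ _ _ (normal_prob 0 s) mu (cst 1)
    (normal_pdf 0 s) id id (fun x => expR (y * x))) => //=.
  - exact: measurable_normal_pdf.
  - by move=> x; exact: normal_pdf_ge0.
  - move=> A mA; transitivity (\int[normal_prob 0 s]_x (\1_A x)%:E)%E.
      by apply: eq_integral => x _; rewrite mul1r.
    rewrite integral_indic// setIT.
    transitivity (\int[mu]_(x in A) (normal_pdf 0 s x)%:E)%E; first by [].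
    rewrite [LHS]integral_mkcond.
    apply: eq_integral => x _; rewrite patchE indicE.
    by case: ifPn => _; rewrite ?mulr1// mulr0.
(* Completing the square: the exponential tilt moves the centre of the density from 0 to y s^2. *)
transitivity (\int[mu]_x ((expR (y ^+ 2 * s ^+ 2 / 2))%:E *
    (normal_pdf (y * s ^+ 2) s x)%:E))%E.
  apply: eq_integral => x _; rewrite -EFinM; congr EFin.
  have pdfE z : normal_pdf z s x = normal_peak s * normal_fun z s x.
    by rewrite normal_pdfE.
  rewrite !pdfE -(mulrA (normal_peak s)) [RHS]mulrCA; congr (normal_peak s * _).
  rewrite /normal_fun -!expRD; congr expR.
  by field.
rewrite ge0_integralZl//.
- by rewrite integral_normal_pdf mule1.
- by apply/measurable_EFinP; exact: measurable_normal_pdf.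
- by move=> x _; rewrite lee_fin normal_pdf_ge0.
Qed.

(** * Wiener integrals *)

Section step_partition.
Context {R : realType}.
Variables (t : R) (h : seq (R * R * R)).
Hypothesis th : step_on t h.

(** Common refinement of the possibly overlapping intervals of [h]: on the cells between consecutive
    distinct endpoints the step function is constant, and the increments of [W] over the cells are
    independent. *)
Let pts : seq R := sort <=%O (undup (map (fun j => j.1.1) h ++ map (fun j =>
  j.1.2) h)).
Definition step_partition (i : nat) : R := nth 0 pts i.
Definition step_partition_size : nat := (size pts).-1.
Local Notation n := step_partition_size.
Local Notation tau := step_partition.

Let mem_pts x : (x \in pts) = (x \in map (fun j => j.1.1) h ++ map (fun j =>
  j.1.2) h).
Proof. by rewrite mem_sort mem_undup. Qed.

Let tau_lt (i k : nat) : (i < size pts)%N -> (k < size pts)%N ->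
  (tau i < tau k) = (i < k)%N.
Proof.
move=> ni nk; apply: lt_sorted_ltn_nth => //.
by rewrite sort_lt_sorted undup_uniq.
Qed.

Let size_pts (i : nat) : (i < n)%N -> (i.+1 < size pts)%N.
Proof. by rewrite /n; case: (size pts). Qed.

Lemma step_partition_lt i : (i < n)%N -> tau i < tau i.+1.
Proof. by move=> /size_pts ni; rewrite tau_lt//; exact: ltnW. Qed.

Lemma step_partition_ge0 i : 0 <= tau i.
Proof.
(* Past the last point [tau] has the default value 0. *)
have [ni|ni] := ltnP i (size pts); last by rewrite /tau nth_default.
have : tau i \in pts by exact: mem_nth.
rewrite mem_pts mem_cat => /orP[] /mapP[j jh ->];
  by have /and3P[j1 j2 _] := allP th j jh; rewrite ?(le_trans j1).
Qed.

Let ptsP x : x \in pts -> exists2 k, (k <= n)%N & x = tau k /\ (k < size pts)%N.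
Proof.
move=> xp; exists (index x pts).
  by move: (xp); rewrite -index_mem /n; case: (size pts).
by rewrite /tau nth_index// index_mem.
Qed.

Let memP j : j \in h -> j.1.1 \in pts /\ j.1.2 \in pts.
Proof.
move=> jh; rewrite !mem_pts !mem_cat; split; apply/orP; [left|right].
  exact: (map_f (fun j => j.1.1)).
exact: (map_f (fun j => j.1.2)).
Qed.

(** Both endpoints of an interval of [h] are partition points, so a cell lies inside the interval
    exactly when its right end does; the selected cells telescope. *)
Let telescope_indic (F : R -> R) j : j \in h ->
  F j.1.2 - F j.1.1 =
  \sum_(i < n) \1_(`]j.1.1, j.1.2]) (tau i.+1) * (F (tau i.+1) - F (tau i)).
Proof.
move=> jh; have [/ptsP[k kn [uk ks]] /ptsP[l ln [vl ls]]] := memP jh.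
have kl : (k <= l)%N.
  rewrite leqNgt -tau_lt// -leNgt -uk -vl.
  by have /and3P[] := allP th j jh.
rewrite uk vl -(telescope_sumr (F \o tau) kl)/= -(big_mkord xpredT
  (fun i => \1_(`]tau k, tau l]) (tau i.+1) * (F (tau i.+1) - F (tau i)))).
rewrite (big_cat_nat (leq0n k))/=; last exact: leq_trans kl ln.
rewrite [X in _ = X + _]big_nat_cond [X in _ = X + _]big1 ?add0r; last first.
  move=> i /andP[/andP[_ ik] _]; rewrite indicE memNset ?mul0r//= in_itv/=.
  have i1 : (i.+1 < size pts)%N by exact: leq_ltn_trans ks.
  by move=> /andP[]; rewrite tau_lt// ltnNge ik.
rewrite (big_cat_nat kl ln)/= [X in _ = _ + X]big_nat_cond [X in _ = _ + X]big1
  ?addr0; last first.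
  move=> i /andP[/andP[li ni] _]; rewrite indicE memNset ?mul0r//= in_itv/=.
  by move=> /andP[_]; rewrite leNgt tau_lt ?ltnS ?li//; exact: size_pts.
apply: eq_big_nat => i /andP[ki il]; rewrite indicE mem_set ?mul1r//= in_itv/=.
have i1 : (i.+1 < size pts)%N by exact: leq_ltn_trans ls.
by rewrite tau_lt// ltnS ki/= leNgt tau_lt// -leqNgt.
Qed.

(** [F] is arbitrary because two instances are needed: a path of [W] rewrites the step integral, and
    the indicator of s <= x rewrites the step function itself. *)
Lemma step_sum_partition (F : R -> R) :
  \sum_(j <- h) j.2 * (F j.1.2 - F j.1.1) =
  \sum_(i < n) step_fun h (tau i.+1) * (F (tau i.+1) - F (tau i)).
Proof.
under [RHS]eq_bigr do rewrite mulr_suml.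
rewrite exchange_big/= big_seq [RHS]big_seq; apply: eq_bigr => j jh.
rewrite (telescope_indic F jh) mulr_sumr; apply: eq_bigr => i _.
by rewrite mulrA.
Qed.

Let indic_oc (u v s : R) : u <= v ->
  \1_(`]u, v]) s = (s <= v)%R%:R - (s <= u)%R%:R :> R.
Proof.
move=> uv; rewrite indicE; have [su|us] := leP s u.
  by rewrite (le_trans su uv) subrr memNset//= in_itv/= ltNge su.
rewrite subr0; congr (_%:R).
by rewrite mem_setE in_itv/= us.
Qed.

Let step_fun_partition s :
  step_fun h s = \sum_(i < n) step_fun h (tau i.+1) * \1_(`]tau i, tau i.+1]) s.
Proof.
transitivity (\sum_(j <- h) j.2 * ((s <= j.1.2)%R%:R - (s <= j.1.1)%R%:R)).
  rewrite /step_fun !big_seq; apply: eq_bigr => j jh; rewrite indic_oc//.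
  by have /and3P[] := allP th j jh.
rewrite (step_sum_partition (fun x => (s <= x)%R%:R)); apply: eq_bigr => i _.
by rewrite indic_oc// ltW// step_partition_lt.
Qed.

Let step_fun_cell i s : (i < n)%N -> tau i < s -> s <= tau i.+1 ->
  step_fun h s = step_fun h (tau i.+1).
Proof.
move=> ni si si1; rewrite /step_fun !big_seq; apply: eq_bigr => j jh.
have [/ptsP[k kn [uk ks]] /ptsP[l ln [vl ls]]] := memP jh.
have i1 := size_pts ni; have i0 := ltnW i1.
congr (_ * _); rewrite !indicE uk vl; congr (_%:R).
(* No partition point lies strictly inside a cell, so [s] and the right end of its cell compare
   alike with all endpoints. *)
have E k' : (k' < size pts)%N -> (tau k' < s) = (tau k' < tau i.+1).
  move=> k's; rewrite tau_lt// ltnS; apply/idP/idP => [k'i|k'i].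
    by rewrite -ltnS -tau_lt//; exact: lt_le_trans si1.
  by apply: le_lt_trans si; rewrite leNgt tau_lt// -leqNgt.
by rewrite !mem_setE !in_itv/= !(leNgt _ (tau l)) !E.
Qed.

(** The cells are disjoint, so there are no cross terms: one factor is expanded over the cells, the
    other is constant on each of them. *)
Lemma step_fun_sqr s :
  step_fun h s ^+ 2 = \sum_(i < n) step_fun h
    (tau i.+1) ^+ 2 * \1_(`]tau i, tau i.+1]) s.
Proof.
rewrite expr2 {1}step_fun_partition mulr_suml; apply: eq_bigr => i _.
rewrite expr2 -!mulrA; congr (_ * _); rewrite indicE.
have [/set_mem/=|] := boolP (s \in _); last by rewrite !(mul0r, mulr0).
by rewrite in_itv/= => /andP[si si1]; rewrite mul1r mulr1; exact: step_fun_cell.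
Qed.

Lemma integral_step_fun_sqr :
  (\int[@lebesgue_measure R]_s (step_fun h s ^+ 2)%:E =
   (\sum_(i < n) step_fun h (tau i.+1) ^+ 2 * (tau i.+1 - tau i))%:E)%E.
Proof.
under eq_integral do rewrite step_fun_sqr -sumEFin.
rewrite ge0_integral_sum//; last 2 first.
- by move=> i; apply/measurable_EFinP; exact: measurable_funM.
- by move=> i s _; rewrite lee_fin mulr_ge0// sqr_ge0.
rewrite -sumEFin; apply: eq_bigr => i _.
under eq_integral do rewrite EFinM.
rewrite ge0_integralZl//; last 2 first.
- exact/measurable_EFinP.
- by rewrite lee_fin sqr_ge0.
rewrite integral_indic//= setIT lebesgue_measure_itv/= lte_fin
  step_partition_lt//.
Qed.

End step_partition.

(** * Exponential moments and tails of step integrals *)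

Section wiener_step_integral.
Context d (Omega : measurableType d) (R : realType) (P : probability Omega R).
Variable W : R -> {RV P >-> R}.
Hypothesis hW : standard_wiener W.

Let mW (u v : R) : measurable_fun [set: Omega] (fun w => W v w - W u w).
Proof. exact: measurable_funB. Qed.

Let wiener_increment_mgf (u v y : R) : 0 <= u -> u < v ->
  (\int[P]_w (expR (y * (W v w - W u w)))%:E = (expR (y ^+ 2 *
    (v - u) / 2))%:E)%E.
Proof.
move=> u0 uv; have uv0 : 0 < v - u by rewrite subr_gt0.
have s0 : Num.sqrt (v - u) != 0 by rewrite gt_eqF// sqrtr_gt0.
have := normal_expR y s0; rewrite sqr_sqrtr ?(ltW uv0)// => <-.
transitivity (\int[P]_w (cst 1 w * expR (y * (W v w - W u w)))%:E)%E.
  by apply: eq_integral => w _; rewrite mul1r.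
transitivity (\int[normal_prob 0 (Num.sqrt (v - u))]_x (cst 1 x * expR
  (y * x))%:E)%E; last first.
  by apply: eq_integral => x _; rewrite mul1r.
apply: (@eq_weighted_integral _ _ _ _ _ P (normal_prob 0 (Num.sqrt (v - u)))
  (cst 1) (cst 1) (fun w => W v w - W u w) id (fun x => expR (y * x))) => //=.
- move=> A mA.
  transitivity (\int[P]_w (\1_[set w | A (W v w - W u w)] w)%:E)%E.
    by apply: eq_integral => w _; rewrite mul1r !indicE.
  transitivity (\int[normal_prob 0 (Num.sqrt (v - u))]_x (\1_A x)%:E)%E;
    last first.
    by apply: eq_integral => x _; rewrite mul1r.
  rewrite !integral_indic// ?setIT//; first exact: (wiener_gaussian hW).
  by rewrite -[X in measurable X]setTI; exact: mW.
- by apply: measurableT_comp => //; exact: measurable_funM.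
Qed.

(** On the refined partition the exponential factors into independent Gaussian terms, whose
    variances add up to the squared L^2 norm [q] of the step function. *)
Lemma step_integral_mgf (t : R) (h : seq (R * R * R)) (q y : R) : step_on t h ->
  (\int[@lebesgue_measure R]_s (step_fun h s ^+ 2)%:E = q%:E)%E ->
  (\int[P]_w (expR (y * step_integral W h w))%:E = (expR (y ^+ 2 * q / 2))%:E)%E.
Proof.
move=> th; rewrite (integral_step_fun_sqr th) => -[<-].
set n := step_partition_size h; set tau := step_partition h.
pose D i w := W (tau i.+1) w - W (tau i) w.
pose z i := y * step_fun h (tau i.+1).
transitivity (\int[P]_w (\prod_(i < n) expR (z i * D i w))%:E)%E.
  apply: eq_integral => w _; rewrite -expR_sum; congr (expR _)%:E.
  rewrite /step_integral (step_sum_partition th (fun x => W x w)) mulr_sumr.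
  by apply: eq_bigr => i _; rewrite mulrA.
have tau_le i : (i < n)%N -> tau i <= tau i.+1 by move=> /step_partition_lt/ltW.
have tau0 : 0 <= tau 0%N by exact: step_partition_ge0 th _.
have indep := fun A => wiener_independent hW (n := n) (t := tau)
  (A := A) tau0 tau_le.
rewrite (@integral_prod_independent _ _ _ P n D _ _ (fun i x => expR (z i * x))
  (fun i => expR (z i ^+ 2 * (tau i.+1 - tau i) / 2)))//.
- rewrite -expR_sum; congr (expR _)%:E.
  rewrite mulr_sumr mulr_suml; apply: eq_bigr => i _.
  by rewrite /z exprMn !mulrA.
- by move=> i; exact: mW.
- by move=> i; apply: measurableT_comp => //; exact: measurable_funM.
- move=> i ni; apply: wiener_increment_mgf; first exact: step_partition_ge0 th _.
  exact: step_partition_lt.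
Qed.

Lemma measurable_step_integral (h : seq (R * R * R)) :
  measurable_fun [set: Omega] (step_integral W h).
Proof.
by apply: measurable_sum => j; apply: measurable_funM => //; exact: mW.
Qed.

(** Markov's inequality for the exponential moments at 1/s and -1/s, one for each sign, whence the
    factor 2. This fixed choice gives an exponential bound, which is enough for Borel-Cantelli. *)
Lemma step_integral_tail (t : R) (h : seq (R * R * R)) (s x : R) :
  step_on t h -> 0 < s ->
  (\int[@lebesgue_measure R]_u (step_fun h u ^+ 2)%:E <= (s ^+ 2)%:E)%E ->
  (P [set w | x <= `|step_integral W h w|]%R <= (2 * expR (1 - x / s))%:E)%E.
Proof.
move=> th s0 hs; set S := step_integral W h.
have mS : measurable_fun [set: Omega] S by exact: measurable_step_integral.
have [q qE] : exists q, (\int[@lebesgue_measure R]_u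
  (step_fun h u ^+ 2)%:E = q%:E)%E.
  by eexists; exact: integral_step_fun_sqr th.
have mexp y : measurable_fun [set: Omega] (fun w => expR (y * S w)).
  by apply: measurableT_comp => //; exact: measurable_funM.
have mA : measurable [set w | x <= `|S w|].
  rewrite -[X in measurable X]setTI.
  apply: (measurable_fun_le (f := cst x) (g := fun w => `|S w|)) => //.
  exact: measurableT_comp.
(* The exponent q / (2 s^2) is at most 1/2, here rounded up to 1. *)
have mgf1 y : y ^+ 2 = (s^-1) ^+ 2 -> (\int[P]_w (expR (y * S w))%:E <=
  (expR 1)%:E)%E.
  move=> ys; rewrite (step_integral_mgf y th qE) lee_fin ler_expR ys.
  move: hs; rewrite qE lee_fin => qs.
  rewrite ler_pdivrMr// mul1r exprVn mulrC ler_pdivrMr ?exprn_gt0//.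
  by apply: (le_trans qs); rewrite ler_peMl ?sqr_ge0// ler1n.
pose B w := (expR (s^-1 * S w) + expR (- s^-1 * S w)) * expR (- (x / s)).
apply: (@le_trans _ _ (\int[P]_w (B w)%:E)%E).
  set A := [set w | _] in mA *.
  have -> : P A = (\int[P]_w (\1_A w)%:E)%E by rewrite integral_indic// setIT.
  apply: ge0_le_integral => //.
  - exact/measurable_EFinP.
  - apply/measurable_EFinP; apply: measurable_funM => //.
    by apply: measurable_funD; exact: mexp.
  move=> w _; rewrite lee_fin indicE /B mulrDl -!expRD.
  have [/set_mem/= xS|_] := boolP (w \in _); last by rewrite addr_ge0// expR_ge0.
  have expR1 z : 0 <= z -> 1 <= expR z by move=> z0;
    rewrite -[leLHS]expR0 ler_expR.
  have [S0|S0] := leP 0 (S w).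
    apply: (@le_trans _ _ (expR (s^-1 * S w - x / s)));
      last by rewrite lerDl expR_ge0.
    by rewrite expR1// mulrC -mulrBl mulr_ge0 ?invr_ge0 ?(ltW s0)// subr_ge0
      -(ger0_norm S0).
  apply: (@le_trans _ _ (expR (- s^-1 * S w - x / s)));
    last by rewrite lerDr expR_ge0.
  rewrite expR1// mulNr -mulrN mulrC -mulrBl mulr_ge0 ?invr_ge0 ?(ltW s0)//
    subr_ge0.
  by rewrite -(ltr0_norm S0).
rewrite /B; under eq_integral do rewrite EFinM EFinD.
rewrite ge0_integralZr//; last 2 first.
- by apply: emeasurable_funD; apply/measurable_EFinP; exact: mexp.
- by move=> w _; rewrite adde_ge0// lee_fin expR_ge0.
rewrite ge0_integralD//; last 2 first.
- by apply/measurable_EFinP; exact: mexp.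
- by apply/measurable_EFinP; exact: mexp.
rewrite expRD mulrA [leRHS]EFinM; apply: lee_wpmul2r;
  first by rewrite lee_fin expR_ge0.
rewrite mulr_natl mulr2n EFinD; apply: leeD; apply: mgf1 => //.
by rewrite sqrrN.
Qed.

End wiener_step_integral.

(** * Passage of the tail bound to the L^2 limit *)

Lemma Lnorm2_integral_sqr d (T : measurableType d) (R : realType)
    (mu : {measure set T -> \bar R}) (f : T -> R) (e : R) : 0 < e ->
  (Lnorm mu 2%:E (EFin \o f) < e%:E)%E ->
  (\int[mu]_x (f x ^+ 2)%:E <= (e ^+ 2)%:E)%E.
Proof.
move=> e0 fe; have -> : (\int[mu]_x (f x ^+ 2)%:E =
    Lnorm mu 2%:E (EFin \o f) `^ 2)%E.
  rewrite poweR_Lnorm//; apply: eq_integral => x _ /=.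
  by rewrite powR_mulrn// real_normK ?num_real.
have -> : ((e ^+ 2)%:E = e%:E `^ 2)%E by rewrite poweR_EFin powR_mulrn// ltW.
by apply: gt0_ler_poweR; rewrite ?in_itv/= ?leey ?andbT ?Lnorm_ge0 ?lee_fin// ltW.
Qed.

Lemma chebyshev_sqr d (T : measurableType d) (R : realType)
    (mu : {measure set T -> \bar R}) (f : T -> R) (y : R) : 0 < y ->
  measurable_fun [set: T] f ->
  (mu [set w | y <= `|f w|]%R <= (y ^- 2)%:E * \int[mu]_x (f x ^+ 2)%:E)%E.
Proof.
move=> y0 mf.
have mA : measurable [set w | y <= `|f w|].
  rewrite -[X in measurable X]setTI.
  apply: (measurable_fun_le (f := cst y) (g := fun w => `|f w|)) => //.
  exact: measurableT_comp.
set A := [set w | _] in mA *.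
have -> : mu A = (\int[mu]_w (\1_A w)%:E)%E by rewrite integral_indic// setIT.
rewrite -ge0_integralZl//; last 3 first.
- by apply/measurable_EFinP; exact: measurable_funX.
- by move=> w _; rewrite lee_fin sqr_ge0.
- by rewrite lee_fin invr_ge0 sqr_ge0.
apply: ge0_le_integral => //.
- exact/measurable_EFinP.
- by apply: measurable_funeM; apply/measurable_EFinP; exact: measurable_funX.
move=> w _; rewrite -EFinM lee_fin indicE.
have [/set_mem/= yf|_] := boolP (w \in _); last first.
  by rewrite mulr_ge0 ?sqr_ge0// invr_ge0 sqr_ge0.
rewrite mulrC ler_pdivlMr ?exprn_gt0// mul1r -(real_normK (num_real (f w))).
by rewrite lerXn2r// nnegrE ?normr_ge0// ltW.
Qed.

Section wiener_integral_tail.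
Context d (Omega : measurableType d) (R : realType) (P : probability Omega R).
Variable W : R -> {RV P >-> R}.
Hypothesis hW : standard_wiener W.
Notation mu := (@lebesgue_measure R).

(** Since overlaps are allowed in the encoding, a difference of step functions is a concatenation
    with negated heights. *)
Let step_neg (h : seq (R * R * R)) := map (fun j => (j.1, - j.2)) h.

Let step_fun_cat h1 h2 s : step_fun (h1 ++ step_neg h2) s = step_fun h1 s -
  step_fun h2 s :> R.
Proof.
rewrite /step_fun big_cat/= big_map -sumrN; congr (_ + _).
by apply: eq_bigr => j _; rewrite mulNr.
Qed.

Let step_integral_cat h1 h2 w :
  step_integral W (h1 ++ step_neg h2) w = step_integral W h1 w - step_integral W
    h2 w.
Proof.
rewrite /step_integral big_cat/= big_map -sumrN; congr (_ + _).
by apply: eq_bigr => j _; rewrite mulNr.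
Qed.

Let step_on_cat (T s t : R) h1 h2 : s <= T -> t <= T -> step_on t h1 ->
  step_on s h2 ->
  step_on T (h1 ++ step_neg h2).
Proof.
move=> sT tT /allP h1t /allP h2s; apply/allP => j;
  rewrite mem_cat => /orP[jh|/mapP[k kh ->]].
  by have /and3P[-> -> /=] := h1t j jh; move=> /le_trans; apply.
by have /and3P[-> -> /=] := h2s k kh; move=> /le_trans; apply.
Qed.

Let step_fun_patch (t : R) h : step_on t h -> step_fun h = step_fun h \_ `[0, t].
Proof.
move=> /allP th; apply/funext => s; rewrite patchE; case: ifPn => // st.
rewrite /step_fun big_seq big1// => j jh; rewrite indicE memNset ?mulr0//= => js.
move: st; rewrite mem_setE in_itv/= => /negP; apply.
have /and3P[j1 j2 j3] := th j jh; move: js; rewrite in_itv/= => /andP[js sj].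
by rewrite (le_trans j1 (ltW js)) (le_trans sj).
Qed.

Let measurable_step_fun h : measurable_fun [set: R] (@step_fun R h).
Proof. by apply: measurable_sum => j; apply: measurable_funM. Qed.

Let sqrD3_le (x y z : R) : (x - y + z) ^+ 2 <= 3 * x ^+ 2 + 3 * y ^+ 2 + 3 * z
  ^+ 2.
Proof.
rewrite -subr_ge0 [leRHS](_ : _ = (x + y) ^+ 2 + (x - z) ^+ 2 + (y + z) ^+ 2);
  last by ring.
by rewrite !addr_ge0// sqr_ge0.
Qed.

Let sqrD2_le (x y : R) : (x - y) ^+ 2 <= 2 * x ^+ 2 + 2 * y ^+ 2.
Proof.
rewrite -subr_ge0 [leRHS](_ : _ = (x + y) ^+ 2); last by ring.
exact: sqr_ge0.
Qed.

(** The difference X - Y is a step integral minus an error [D], and each gets half of [x]. The step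
    function has norm at most 2 sigma, so level x / 2 gives the ratio x / (4 sigma); the error costs
    an arbitrarily small [eta]. *)
Lemma wiener_integral_increment_tail (T s t : R) (f g : R -> R)
    (X Y : {RV P >-> R}) (sigma x : R) :
  s <= T -> t <= T -> 0 < sigma -> 0 < x ->
  is_wiener_integral W t f X -> is_wiener_integral W s g Y ->
  (\int[mu]_v (((f \_ `[0, t]) v - (g \_ `[0, s]) v) ^+ 2)%:E <=
    (sigma ^+ 2)%:E)%E ->
  (P [set w | x <= `|X w - Y w|]%R <= (2 * expR (1 - x / (4 * sigma)))%:E)%E.
Proof.
move=> sT tT sigma0 x0 [Lf [h1 [h1t cf cX]]] [Lg [h2 [h2s cg cY]]] hfg.
apply/lee_addgt0Pr => /= eta eta0.
(* With [e1], the square of the step function integrates to at most 3 e1^2 + 3 e1^2 + 3 sigma^2 =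
   (11/3) sigma^2, below (2 sigma)^2. With [e2], Chebyshev at level x / 2 gives (2 / x)^2 * 4 e2^2 =
   eta. *)
pose e1 := sigma / 3.
have e10 : 0 < e1 by rewrite divr_gt0.
pose e2 := x / 4 * Num.sqrt eta.
have e20 : 0 < e2 by rewrite mulr_gt0 ?sqrtr_gt0// divr_gt0.
have near_lt (u : nat -> \bar R) (e : R) : 0 < e -> u n @[n --> \oo] --> 0%E ->
    \forall n \near \oo, (u n < e%:E)%E.
  move=> e0 /fine_cvgP[ufin cu]; 
  have lte : \forall n \near \oo, fine (u n) < e by exact: (cvgr_lt _ cu).
  move: ufin lte.
  by apply: filterS2 => n un; rewrite -lte_fin /= fineK.
pose Nf n := Lnorm mu 2%:E (EFin \o (step_fun (h1 n) \- f) \_ `[0, t]).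
pose Ng n := Lnorm mu 2%:E (EFin \o (step_fun (h2 n) \- g) \_ `[0, s]).
pose NX n := Lnorm P 2%:E (EFin \o (step_integral W (h1 n) \- X)).
pose NY n := Lnorm P 2%:E (EFin \o (step_integral W (h2 n) \- Y)).
have [n [nf ng nX nY]] : exists n, [/\ (Nf n < e1%:E)%E, (Ng n < e1%:E)%E,
    (NX n < e2%:E)%E & (NY n < e2%:E)%E].
  apply: (@filter_ex _ (nbhs \oo)).
  near=> n; split; near: n; exact: near_lt.
pose h := h1 n ++ step_neg (h2 n).
have hT : step_on T h by exact: step_on_cat (h1t n) (h2s n).
have {}nf := Lnorm2_integral_sqr e10 nf.
have {}ng := Lnorm2_integral_sqr e10 ng.
have {}nX := Lnorm2_integral_sqr e20 nX.
have {}nY := Lnorm2_integral_sqr e20 nY.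
have mf : measurable_fun [set: R] (f \_ `[0, t]) by exact: Lp_on_measurable Lf.
have mg : measurable_fun [set: R] (g \_ `[0, s]) by exact: Lp_on_measurable Lg.
have m1 := measurable_step_fun (h1 n); have m2 := measurable_step_fun (h2 n).
have hsigma : (\int[mu]_u (step_fun h u ^+ 2)%:E <= ((2 * sigma) ^+ 2)%:E)%E.
  pose u1 v := ((step_fun (h1 n) \- f) \_ `[0, t]) v.
  pose u2 v := ((step_fun (h2 n) \- g) \_ `[0, s]) v.
  pose u3 v := (f \_ `[0, t]) v - (g \_ `[0, s]) v.
  have u1E v : u1 v = step_fun (h1 n) v - (f \_ `[0, t]) v.
    by rewrite (step_fun_patch (h1t n)) /u1 !patchE; case: ifP => //;
      rewrite subr0.
  have u2E v : u2 v = step_fun (h2 n) v - (g \_ `[0, s]) v.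
    by rewrite (step_fun_patch (h2s n)) /u2 !patchE; case: ifP => //;
      rewrite subr0.
  have mu1 : measurable_fun [set: R] u1.
    by rewrite (funext u1E); exact: measurable_funB.
  have mu2 : measurable_fun [set: R] u2.
    by rewrite (funext u2E); exact: measurable_funB.
  have mu3 : measurable_fun [set: R] u3 by exact: measurable_funB.
  have msq (u : R -> R) : measurable_fun [set: R] u ->
    measurable_fun [set: R] (fun v => (3 * u v ^+ 2)%:E).
    by move=> mu_; apply/measurable_EFinP; apply: measurable_funM => //;
      exact: measurable_funX.
  have sq0 (u : R -> R) v : (0 <= (3 * u v ^+ 2)%:E)%E
    by rewrite lee_fin mulr_ge0// sqr_ge0.
  have intsq (u : R -> R) (c : R) : measurable_fun [set: R] u ->
      (\int[mu]_v (u v ^+ 2)%:E <= (c ^+ 2)%:E)%E ->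
      (\int[mu]_v (3 * u v ^+ 2)%:E <= (3 * c ^+ 2)%:E)%E.
    move=> mu_ uc; under eq_integral do rewrite EFinM.
    rewrite ge0_integralZl//.
    - by rewrite EFinM lee_wpmul2l.
    - by apply/measurable_EFinP; exact: measurable_funX.
    - by move=> v _; rewrite lee_fin sqr_ge0.
  apply: (@le_trans _ _ (\int[mu]_v ((3 * u1 v ^+ 2)%:E + (3 * u2 v ^+ 2)%:E +
    (3 * u3 v ^+ 2)%:E))%E).
    apply: ge0_le_integral => //.
    - by move=> v _; rewrite lee_fin sqr_ge0.
    - by apply/measurable_EFinP; apply: measurable_funX;
        exact: measurable_step_fun.
    - by apply: emeasurable_funD; [apply: emeasurable_funD|]; exact: msq.
    - move=> v _; rewrite -!EFinD lee_fin step_fun_cat.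
      apply: le_trans (sqrD3_le _ _ _); rewrite u1E u2E /u3 le_eqVlt; apply/orP;
        left; apply/eqP.
      by ring.
  rewrite ge0_integralD//; last 3 first.
  - by move=> v _; rewrite adde_ge0.
  - by apply: emeasurable_funD; exact: msq.
  - exact: msq.
  rewrite ge0_integralD//; [|exact: msq|exact: msq].
  apply: (@le_trans _ _ ((3 * e1 ^+ 2)%:E + (3 * e1 ^+ 2)%:E +
    (3 * sigma ^+ 2)%:E)%E).
    by apply: leeD; [apply: leeD|]; exact: intsq.
  rewrite -!EFinD lee_fin /e1.
  have -> : 3 * (sigma / 3) ^+ 2 + 3 * (sigma / 3) ^+ 2 + 3 * sigma ^+ 2 =
    (11 / 3) * sigma ^+ 2 by field.
  by rewrite exprMn ler_wpM2r ?sqr_ge0//; lra.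
have mX : measurable_fun [set: Omega] X by [].
have mY : measurable_fun [set: Omega] Y by [].
have mS1 := measurable_step_integral W (h1 n).
have mS2 := measurable_step_integral W (h2 n).
have mS := measurable_step_integral W h.
pose D w := (step_integral W (h1 n) w - X w) - (step_integral W (h2 n) w - Y w).
have mD : measurable_fun [set: Omega] D by apply: measurable_funB;
  exact: measurable_funB.
have mle (u : Omega -> R) c : measurable_fun [set: Omega] u ->
  measurable [set w | c <= `|u w|].
  move=> mu_; rewrite -[X in measurable X]setTI.
  apply: (measurable_fun_le (f := cst c) (g := fun w => `|u w|)) => //.
  exact: measurableT_comp.
have x20 : 0 < x / 2 by rewrite divr_gt0.
pose A1 := [set w | x / 2 <= `|step_integral W h w|].
pose A2 := [set w | x / 2 <= `|D w|].
apply: (@le_trans _ _ (P (A1 `|` A2))).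
  apply: le_measure; rewrite ?inE.
  - by apply: mle; exact: measurable_funB.
  - by apply: measurableU; exact: mle.
  move=> w /= xw; have [?|hS] := leP (x / 2) `|step_integral W h w|;
    first by left.
  right; rewrite /A2/= leNgt; apply/negP => hD.
  suff : `|X w - Y w| < x by rewrite ltNge xw.
  have -> : X w - Y w = step_integral W h w - D w
    by rewrite step_integral_cat /D; ring.
  by apply: (le_lt_trans (ler_normB _ _)); rewrite [ltRHS](splitr x) ltrD.
apply: (@le_trans _ _ (P A1 + P A2)%E).
  by apply: measureU2; exact: mle.
apply: leeD.
  have s20 : 0 < 2 * sigma by rewrite mulr_gt0.
  apply: le_trans (step_integral_tail hW (x / 2) hT s20 hsigma) _.
  rewrite le_eqVlt; apply/orP; left; apply/eqP; congr (_ * expR (1 - _))%:E.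
  by field; rewrite gt_eqF.
apply: le_trans (chebyshev_sqr P x20 mD) _.
have -> : eta = (x / 2) ^- 2 * (2 * e2 ^+ 2 + 2 * e2 ^+ 2).
  have -> : e2 ^+ 2 = (x / 4) ^+ 2 * eta by rewrite /e2 exprMn sqr_sqrtr// ltW.
  by field; rewrite gt_eqF.
rewrite EFinM; apply: lee_wpmul2l; first by rewrite lee_fin invr_ge0 sqr_ge0.
have msq (u : Omega -> R) : measurable_fun [set: Omega] u ->
  measurable_fun [set: Omega] (fun v => (2 * u v ^+ 2)%:E).
  by move=> mu_; apply/measurable_EFinP; apply: measurable_funM => //;
    exact: measurable_funX.
have intsq (u : Omega -> R) (c : R) : measurable_fun [set: Omega] u ->
    (\int[P]_v (u v ^+ 2)%:E <= (c ^+ 2)%:E)%E ->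
    (\int[P]_v (2 * u v ^+ 2)%:E <= (2 * c ^+ 2)%:E)%E.
  move=> mu_ uc; under eq_integral do rewrite EFinM.
  rewrite ge0_integralZl//.
  - by rewrite EFinM lee_wpmul2l.
  - by apply/measurable_EFinP; exact: measurable_funX.
  - by move=> v _; rewrite lee_fin sqr_ge0.
have mD1 : measurable_fun [set: Omega] (fun w =>
  step_integral W (h1 n) w - X w) by exact: measurable_funB.
have mD2 : measurable_fun [set: Omega] (fun w =>
  step_integral W (h2 n) w - Y w) by exact: measurable_funB.
apply: (@le_trans _ _ (\int[P]_w ((2 * (step_integral W (h1 n) w - X w) ^+ 2)%:E +
    (2 * (step_integral W (h2 n) w - Y w) ^+ 2)%:E))%E).
  apply: ge0_le_integral => //.
  - by move=> w _; rewrite lee_fin sqr_ge0.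
  - by apply/measurable_EFinP; exact: measurable_funX.
  - by apply: emeasurable_funD; exact: msq.
  - by move=> w _; rewrite -EFinD lee_fin; exact: sqrD2_le.
rewrite ge0_integralD//; last 4 first.
- by move=> w _; rewrite lee_fin mulr_ge0// sqr_ge0.
- exact: msq.
- by move=> w _; rewrite lee_fin mulr_ge0// sqr_ge0.
- exact: msq.
by rewrite EFinD; apply: leeD; exact: intsq.
Unshelve. all: by end_near.
Qed.

End wiener_integral_tail.

(** * Dyadic interpolation and Kolmogorov's criterion *)

Lemma ltn_eq_or_succ (k l : nat) : (k < l.+1)%N -> (l < k.+2)%N ->
  l = k \/ l = k.+1.
Proof. lia. Qed.

Section dyadic_interpolation.
Context {R : realType}.
Variable T : R.
Hypothesis T0 : 0 < T.

Definition mesh (n : nat) : R := 2^-1 ^+ n.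
Definition grid (n k : nat) : R := T * k%:R * mesh n.
Definition grid_index (n : nat) (t : R) : nat := Num.truncn (t / T * 2 ^+ n).
Definition grid_floor (n : nat) (t : R) : R := grid n (grid_index n t).

Lemma mesh_gt0 n : 0 < mesh n. Proof. by rewrite exprn_gt0. Qed.

Lemma mesh_le1 n : mesh n <= 1. Proof. by rewrite exprn_ile1// invf_le1// ler1n.
  Qed.

Lemma meshE n : mesh n * 2 ^+ n = 1.
Proof. by rewrite /mesh -exprMn mulVf// expr1n. Qed.

Lemma mesh_powR n (g : R) : mesh n `^ g = (2^-1 `^ g) ^+ n.
Proof.
by rewrite -(powR_mulrn n (powR_ge0 _ _)) -powRrM mulrC powRrM powR_mulrn.
Qed.

Lemma mesh_cvg0 : mesh n @[n --> \oo] --> (0 : R).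
Proof. by apply: cvg_expr; rewrite ger0_norm// invf_lt1// ltr1n. Qed.

Let grid_indexP n t : 0 <= t ->
  (grid_index n t)%:R <= t / T * 2 ^+ n < (grid_index n t).+1%:R.
Proof. by move=> t0; apply: truncn_itv; rewrite !mulr_ge0// ?invr_ge0 ltW. Qed.

Let tE n t : t = T * (t / T * 2 ^+ n) * mesh n.
Proof. by rewrite -[RHS]mulrA -[_ * mesh n]mulrA [_ * mesh n]mulrC meshE mulr1
  mulrC divfK// gt_eqF. Qed.

Lemma grid_ge0 n k : 0 <= grid n k.
Proof. by rewrite !mulr_ge0// ?(ltW T0)// ltW// mesh_gt0. Qed.

Lemma grid_le n k : (k <= 2 ^ n)%N -> grid n k <= T.
Proof.
move=> kn; rewrite /grid -mulrA ler_piMr ?(ltW T0)// -[leRHS](meshE n) mulrC.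
by rewrite ler_wpM2l ?(ltW (mesh_gt0 n))// -natrX ler_nat.
Qed.

Lemma gridS n k : grid n k.+1 - grid n k = T * mesh n.
Proof. by rewrite /grid -natr1; ring. Qed.

Lemma grid_index_le n t : 0 <= t -> t <= T -> (grid_index n t <= 2 ^ n)%N.
Proof.
move=> t0 tT; have /andP[h _] := grid_indexP n t0.
rewrite -(ler_nat R) natrX; apply: le_trans h _.
by rewrite ler_piMl ?exprn_ge0// ler_pdivrMr// mul1r.
Qed.

Lemma grid_floor_le n t : 0 <= t -> grid_floor n t <= t.
Proof.
move=> t0; have /andP[h _] := grid_indexP n t0.
by rewrite [leRHS](tE n) ler_wpM2r ?(ltW (mesh_gt0 n))// ler_wpM2l ?(ltW T0).
Qed.

Lemma grid_floor_ge n t : 0 <= t -> t - grid_floor n t <= T * mesh n.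
Proof.
move=> t0; have /andP[_ h] := grid_indexP n t0.
rewrite lerBlDr -(gridS n (grid_index n t)) subrK [leLHS](tE n).
by rewrite ler_wpM2r ?(ltW (mesh_gt0 n))// ler_wpM2l ?(ltW T0)// ltW.
Qed.

Section dyadic_path.
Variables (x : R -> R) (g G : R).
Hypotheses (g0 : 0 < g) (G0 : 0 <= G).
Hypothesis xG : forall n k, (k < 2 ^ n)%N ->
  `|x (grid n k.+1) - x (grid n k)| <= G * mesh n `^ g.

Let theta : R := 2^-1 `^ g.
Let theta0 : 0 < theta. Proof. by rewrite powR_gt0. Qed.
Let theta1 : theta < 1.
Proof.
have : 2^-1 `^ g < 1 `^ g :> R.
  by apply: gt0_ltr_powR; rewrite ?nnegrE ?invr_ge0// invf_lt1// ltr1n.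
by rewrite powR1.
Qed.

Let xG' n k : (k < 2 ^ n)%N -> `|x (grid n k.+1) - x
  (grid n k)| <= G * theta ^+ n.
Proof. by move=> /xG; rewrite mesh_powR. Qed.

Let Gt0 n : 0 <= G * theta ^+ n.
Proof. by rewrite mulr_ge0// exprn_ge0// ltW. Qed.

(** Refining the grid either keeps the point below [t] or moves it to its right neighbour on the
    finer grid, so at most one grid increment is paid. *)
Let grid_floorS n t : 0 <= t -> t <= T ->
  `|x (grid_floor n.+1 t) - x (grid_floor n t)| <= G * theta ^+ n.+1.
Proof.
move=> t0 tT; rewrite /grid_floor.
set k := grid_index n t; set l := grid_index n.+1 t.
have -> : grid n k = grid n.+1 k.*2.
  by rewrite /grid /mesh exprS -mul2n natrM; field.
have /andP[k1 k2] := grid_indexP n t0; rewrite -/k in k1 k2.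
have /andP[l1 l2] := grid_indexP n.+1 t0; rewrite -/l in l1 l2.
have kl : (k.*2 < l.+1)%N.
  rewrite -(ltr_nat R); apply: le_lt_trans l2.
  by rewrite -mul2n natrM exprS mulrCA ler_pM2l.
have lk : (l < k.*2.+2)%N.
  rewrite -(ltr_nat R); apply: le_lt_trans l1 _.
  by rewrite -doubleS -mul2n natrM exprS mulrCA ltr_pM2l.
have [->|lE] := ltn_eq_or_succ kl lk.
  by rewrite subrr normr0.
by rewrite lE xG'//; rewrite -lE grid_index_le.
Qed.

(** Times at most one mesh apart lie in the same cell or in adjacent ones. *)
Let grid_floor_near n s t : 0 <= s -> s <= t -> t <= T -> t - s <= T * mesh n ->
  `|x (grid_floor n t) - x (grid_floor n s)| <= G * theta ^+ n.
Proof.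
move=> s0 st tT ts; have t0 := le_trans s0 st; rewrite /grid_floor.
set k := grid_index n s; set l := grid_index n t.
have /andP[k1 k2] := grid_indexP n s0; rewrite -/k in k1 k2.
have /andP[l1 l2] := grid_indexP n t0; rewrite -/l in l1 l2.
have st' : s / T * 2 ^+ n <= t / T * 2 ^+ n.
  by rewrite ler_wpM2r ?exprn_ge0// ler_wpM2r// invr_ge0 ltW.
have ts' : t / T * 2 ^+ n <= s / T * 2 ^+ n + 1.
  rewrite -lerBlDl -!mulrBl -[leRHS](meshE n) ler_wpM2r ?exprn_ge0//.
  by rewrite ler_pdivrMr// mulrC.
have kl : (k < l.+1)%N by rewrite -(ltr_nat R) (le_lt_trans k1)//
  (le_lt_trans st').
have lk : (l < k.+2)%N.
  by rewrite -(ltr_nat R) (le_lt_trans l1)// (le_lt_trans ts')// -[ltRHS]natr1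
    ltrD2r.
have [->|lE] := ltn_eq_or_succ kl lk.
  by rewrite subrr normr0.
by rewrite lE xG'//; rewrite -lE grid_index_le.
Qed.

(** The geometric series of the powers of [theta] from the first on: the total cost of all
    refinements after a given level, relative to that level. *)
Let tail_const := theta / (1 - theta).
Let tail_const0 : 0 <= tail_const.
Proof. by rewrite divr_ge0 ?subr_ge0 ?(ltW theta0)// ltW. Qed.

Let grid_floor_dist n m t : 0 <= t -> t <= T -> (n <= m)%N ->
  `|x (grid_floor m t) - x (grid_floor n t)| <= G * tail_const * theta ^+ n.
Proof.
move=> t0 tT /subnKC <-; set k := (m - n)%N; clearbody k; clear m.
have th1 : 0 < 1 - theta by rewrite subr_gt0.
(* The factor 1 - theta^k is the exact partial geometric sum, and it makes the induction on [k]
   close. *)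
suff : `|x (grid_floor (n + k) t) - x (grid_floor n t)| <=
    G * tail_const * theta ^+ n * (1 - theta ^+ k).
  move=> /le_trans; apply; rewrite ler_piMr//.
    by rewrite mulr_ge0 ?(mulr_ge0 G0)// exprn_ge0// ltW.
  by rewrite lerBlDr lerDl exprn_ge0// ltW.
elim: k => [|k IH]; first by rewrite addn0 !subrr normr0 mulr0.
rewrite addnS.
rewrite (_ : _ - _ = (x (grid_floor (n + k).+1 t) - x (grid_floor (n + k) t)) +
  (x (grid_floor (n + k) t) - x (grid_floor n t))); last by ring.
apply: (le_trans (ler_normD _ _)).
apply: (le_trans (lerD (grid_floorS (n + k) t0 tT) IH)).
rewrite le_eqVlt; apply/orP; left; apply/eqP.
rewrite /tail_const exprS exprD exprS; field.
by rewrite gt_eqF.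
Qed.

Lemma dyadic_path_cvg t : 0 <= t -> t <= T -> cvgn (fun n => x (grid_floor n t)).
Proof.
move=> t0 tT; apply/cauchy_cvgP; apply: cauchy_exP => /= e e0.
have : G * tail_const * theta ^+ n @[n --> \oo] --> G * tail_const * 0.
  by apply: cvgMr; apply: cvg_expr; rewrite ger0_norm// ltW.
rewrite mulr0 => /cvgr_lt/(_ e e0)[n _ hn].
exists (x (grid_floor n t)); exists n => // m /= nm.
rewrite /ball/= distrC.
by apply: le_lt_trans (grid_floor_dist t0 tT nm) _; apply: hn => /=.
Qed.

(** One grid step and two refinement tails give 1 + 2 [tail_const] at level n; the divisors convert
    theta^n into (t - s)^g through T * mesh (n + 1) < t - s. *)
Definition dyadic_const : R := (1 + 2 * tail_const) / theta / T `^ g.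

Lemma dyadic_const_ge0 : 0 <= dyadic_const.
Proof.
by rewrite !divr_ge0 ?powR_ge0 ?(ltW theta0)// addr_ge0// mulr_ge0.
Qed.

Lemma dyadic_path_holder (y : R -> R) s t : 0 <= s -> s < t -> t <= T ->
  x (grid_floor n s) @[n --> \oo] --> y s -> x
    (grid_floor n t) @[n --> \oo] --> y t ->
  `|y t - y s| <= dyadic_const * G * (t - s) `^ g.
Proof.
move=> s0 st tT ys yt; have t0 := ltW (le_lt_trans s0 st).
have sT := ltW (lt_le_trans st tT); have ts0 : 0 < t - s by rewrite subr_gt0.
have lim_dist n u : 0 <= u -> u <= T -> x (grid_floor m u) @[m --> \oo] --> y u ->
    `|y u - x (grid_floor n u)| <= G * tail_const * theta ^+ n.
  move=> u0 uT yu.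
  have : `|x (grid_floor m u) - x (grid_floor n u)| @[m --> \oo] --> `|y u - x
    (grid_floor n u)|.
    by apply: cvg_norm; apply: cvgB => //; exact: cvg_cst.
  move=> /cvg_lim <-//; apply: limr_le.
    by apply/cvg_ex; eexists; apply: cvg_norm; apply: cvgB;
      [exact: yu|exact: cvg_cst].
  by near=> m; apply: grid_floor_dist => //; near: m; exists n.
have exn : exists n, T * mesh n.+1 < t - s.
  have : T * mesh n @[n --> \oo] --> T * 0 by apply: cvgMr; exact: mesh_cvg0.
  rewrite mulr0 => /cvgr_lt/(_ (t - s) ts0)[n _ hn].
  by exists n; apply: hn => /=.
(* The least such [n] puts t - s between T * mesh (n + 1) and T * mesh n; for n = 0 the upper bound
   is t - s <= T. *)
have [n nts nmin] := ex_minnP exn.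
have tsn : t - s <= T * mesh n.
  case: n nts nmin => [_ _|n _ nmin]; first by rewrite /mesh expr0 mulr1; lra.
  by rewrite leNgt; apply/negP => /nmin; rewrite ltnn.
have th1 : 0 < 1 - theta by rewrite subr_gt0.
apply: (@le_trans _ _ (G * theta ^+ n * (1 + 2 * tail_const))).
  rewrite (_ : y t - y s = (y t - x (grid_floor n t)) +
    (x (grid_floor n t) - x (grid_floor n s)) - (y s - x (grid_floor n s)));
      last by ring.
  apply: (le_trans (ler_normB _ _)); apply: (le_trans (lerD (ler_normD _ _)
    (lexx _))).
  apply: (le_trans (lerD (lerD (lim_dist n t t0 tT yt) (grid_floor_near s0
    (ltW st) tT tsn))
    (lim_dist n s s0 sT ys))).
  by rewrite le_eqVlt; apply/orP; left; apply/eqP; ring.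
have thn : theta ^+ n <= (t - s) `^ g / theta / T `^ g.
  rewrite ler_pdivlMr ?powR_gt0// ler_pdivlMr// mulrAC -exprSr mulrC.
  rewrite /theta -mesh_powR -powRM ?(ltW T0) ?(ltW (mesh_gt0 _))//.
  by apply: ge0_ler_powR; rewrite ?nnegrE ?mulr_ge0 ?(ltW T0) ?(ltW
    (mesh_gt0 _)) ?ltW.
rewrite /dyadic_const.
have c0 : 0 <= 1 + 2 * tail_const.
  by rewrite addr_ge0// mulr_ge0.
apply: (@le_trans _ _ (G * ((t - s) `^ g / theta / T `^ g) *
  (1 + 2 * tail_const))).
  by rewrite ler_wpM2r// ler_wpM2l.
by rewrite le_eqVlt; apply/orP; left; apply/eqP; ring.
Unshelve. all: by end_near. Qed.

End dyadic_path.
End dyadic_interpolation.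

(** * Borel-Cantelli and the Hoelder modification *)

Section kolmogorov_continuity.
Context d (Omega : measurableType d) (R : realType) (P : probability Omega R).
Variables (X : R -> {RV P >-> R}) (T lambda kappa : R).
Hypotheses (T0 : 0 < T) (lambda0 : 0 < lambda) (kappa0 : 0 < kappa).
Hypothesis tailX : forall s t x : R, 0 <= s -> s < t -> t <= T -> 0 < x ->
  (P [set w | x <= `|X t w - X s w|]%R <=
   (2 * expR (1 - x / (kappa * (t - s) `^ lambda)))%:E)%E.

Let mXX s t : measurable_fun [set: Omega] (fun w => `|X t w - X s w|).
Proof. by apply: measurableT_comp => //; exact: measurable_funB. Qed.

Let mbig (s t x : R) : measurable [set w | x <= `|X t w - X s w|].
Proof.
rewrite -[X in measurable X]setTI.
exact: (measurable_fun_le (f := cst x) (g := fun w => `|X t w - X s w|)).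
Qed.

(** A single term of the exponential series bounds expR y from below. *)
Let expRN_le (m : nat) (y : R) : 0 < y -> expR (- y) <= m.+1`!%:R * y ^- m.+1.
Proof.
move=> y0; rewrite expRN -[leRHS]invrK lef_pV2 ?posrE ?expR_gt0//; last first.
  by rewrite invr_gt0 mulr_gt0 ?invr_gt0 ?exprn_gt0// ltr0n fact_gt0.
rewrite invfM invrK mulrC.
by apply: le_trans (expR_ge1Dxn m (ltW y0)); rewrite lerDr.
Qed.

(* Exponential tails beat every power of the mesh. *)
Let mesh_tail (g : R) : g < lambda -> exists2 C : R, 0 < C &
  forall n s t, 0 <= s -> s <= t -> t <= T -> t - s <= T * mesh n ->
  (P [set w | mesh n `^ g <= `|X t w - X s w|]%R <= (C * mesh n ^+ 2)%:E)%E.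
Proof.
move=> gl; have lg : 0 < lambda - g by rewrite subr_gt0.
(* Chosen so that (m + 1) (lambda - g) >= 2. Of the two powers of the mesh so obtained, one pays for
   the 2^n cells of the grid in the union bound, and the other is summable. *)
pose m := Num.truncn (2 / (lambda - g)).
have mlg : 2 <= m.+1%:R * (lambda - g).
  rewrite -ler_pdivrMr//; apply/ltW.
  by have /andP[] := truncn_itv (divr_ge0 (ler0n R 2) (ltW lg)).
pose c := (kappa * T `^ lambda)^-1.
have c0 : 0 < c by rewrite invr_gt0 mulr_gt0 ?powR_gt0.
pose C := 2 * expR 1 * (m.+1`!%:R * c ^- m.+1).
have C0 : 0 < C.
  by rewrite /C !mulr_gt0 ?expR_gt0 ?ltr0n ?fact_gt0// invr_gt0 exprn_gt0.
exists C => // n s t s0 st tT ts; have b0 := mesh_gt0 (R := R) n.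
have bg0 : 0 < mesh n `^ g :> R by exact: powR_gt0.
move: st; rewrite le_eqVlt => /predU1P[<-|st].
  rewrite [X in P X](_ : _ = set0).
    by rewrite measure0 lee_fin; apply: mulr_ge0; [exact: ltW|exact: sqr_ge0].
  by apply/seteqP; split => w //=; rewrite subrr normr0 leNgt bg0.
apply: le_trans (tailX s0 st tT bg0) _; rewrite lee_fin expRD /C -mulrA
  -[leRHS]mulrA.
rewrite ler_pM2l// ler_pM2l ?expR_gt0//.
have ts0 : 0 < t - s by rewrite subr_gt0.
(* The worst case of the ratio in the tail bound, attained when t - s is T * mesh n. *)
pose y := c * mesh n `^ (g - lambda).
have y0 : 0 < y by rewrite mulr_gt0 ?powR_gt0.
have yle : y <= mesh n `^ g / (kappa * (t - s) `^ lambda).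
  rewrite ler_pdivlMr ?mulr_gt0 ?powR_gt0// /y.
  rewrite powRD; last by rewrite (gt_eqF b0) implybT.
  have : (t - s) `^ lambda <= T `^ lambda * mesh n `^ lambda.
    rewrite -powRM ?(ltW T0) ?(ltW b0)//.
    apply: ge0_ler_powR => //; rewrite ?nnegrE ?(ltW lambda0) ?(ltW ts0)//.
    by rewrite mulr_ge0// ltW.
  move=> tsl; apply: (@le_trans _ _ (c * (mesh n `^ g * mesh n `^ (- lambda)) *
      (kappa * (T `^ lambda * mesh n `^ lambda)))).
    rewrite ler_wpM2l ?mulr_ge0 ?(ltW c0) ?powR_ge0//.
    by rewrite ler_wpM2l ?(ltW kappa0).
  rewrite powRN /c le_eqVlt; apply/orP; left; apply/eqP; field.
  by rewrite !gt_eqF ?powR_gt0.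
apply: (@le_trans _ _ (expR (- y))); first by rewrite ler_expR lerN2.
apply: (le_trans (expRN_le m y0)); rewrite -mulrA ler_wpM2l ?ler0n//.
rewrite /y exprMn invfM ler_wpM2l ?invr_ge0 ?exprn_ge0 ?(ltW c0)//.
rewrite -(powR_mulrn m.+1 (powR_ge0 _ _)) -powRrM -powRN -(powR_mulrn 2 (ltW b0)).
rewrite (_ : - _ = m.+1%:R * (lambda - g)); last by ring.
have [->|b1] := eqVneq (mesh n : R) 1; first by rewrite !powR1.
by apply: ger_powR => //; rewrite b0 mesh_le1.
Qed.

Let lim_sup0 (F : (set Omega)^nat) (C : R) : 0 < C ->
  (forall n, measurable (F n)) ->
  (forall n, P (F n) <= (C * mesh n)%:E)%E -> P (lim_sup_set F) = 0%E.
Proof.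
move=> C0 mF PF; apply: lim_sup_set_cvg0 => //.
apply: (@le_lt_trans _ _ (\sum_(n <oo) (2 * C / (2 ^ n.+1)%:R)%:E)%E).
  apply: lee_nneseries => // n _; apply: le_trans (PF n) _.
  rewrite lee_fin /mesh expnS natrM natrX exprVn le_eqVlt; apply/orP; left;
    apply/eqP.
  by field.
apply: le_lt_trans (ltry (2 * C)).
by apply: (epsilon_trick0 xpredT); rewrite mulr_ge0// ltW.
Qed.

Let bad (g : R) (n : nat) : set Omega := \big[setU/set0]_(k < 2 ^ n)
  [set w | mesh n `^ g <= `|X (grid T n k.+1) w - X (grid T n k) w|].

Let mbad g n : measurable (bad g n).
Proof. by apply: bigsetU_measurable => k _; exact: mbig. Qed.

Let bad_lim_sup0 g : g < lambda -> P (lim_sup_set (bad g)) = 0%E.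
Proof.
move=> /mesh_tail[C C0 HC]; apply: (lim_sup0 C0) => // n.
pose A k := [set w | mesh n `^ g <= `|X (grid T n k.+1) w - X (grid T n k) w|].
have mA k : measurable (A k) by exact: mbig.
apply: (le_trans (@Boole_inequality _ _ _ P A (2 ^ n)%N (fun k _ => mA k))).
apply: (@le_trans _ _ (\sum_(k < 2 ^ n) (C * mesh n ^+ 2)%:E)%E).
  apply: lee_sum => k _; apply: HC.
  - exact: grid_ge0.
  - by rewrite -subr_ge0 gridS mulr_ge0 ?(ltW T0)// ltW// mesh_gt0.
  - by apply: grid_le.
  - by rewrite gridS.
rewrite sumEFin sumr_const card_ord lee_fin -mulr_natr natrX expr2.
rewrite le_eqVlt; apply/orP; left; apply/eqP.
by rewrite -!mulrA meshE mulr1.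
Qed.

(* Countably many exponents suffice, since these increase to [lambda]. *)
Let gam (k : nat) : R := lambda * (k.+1%:R / k.+2%:R).

Let gam_lt k : gam k < lambda.
Proof. by rewrite /gam mulrA ltr_pdivrMr// ltr_pM2l// ltr_nat. Qed.

Let gam_gt0 k : 0 < gam k.
Proof. by rewrite mulr_gt0// divr_gt0. Qed.

Let gam_cofinal (g : R) : 0 < g -> g < lambda -> exists k, g < gam k.
Proof.
move=> g0 gl; have lg : 0 < lambda - g by rewrite subr_gt0.
(* The inequality g < gam k amounts to lambda < (lambda - g) (k + 2); this witness gives it already
   with k + 1. *)
exists (Num.truncn (lambda / (lambda - g))).
have /andP[_] := truncn_itv (divr_ge0 (ltW lambda0) (ltW lg)).
set k := Num.truncn _; rewrite ltr_pdivrMr// => h.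
rewrite /gam mulrA ltr_pdivlMr//.
rewrite -natr1 mulrDr mulr1; move: h; rewrite mulrBr => h.
move: h; rewrite ltrBrDr => h; rewrite addrC (mulrC g) (mulrC lambda).
by apply: lt_trans h; rewrite ltrD2r.
Qed.

(** One null set for all exponents and all times; off it the modification is the limit along dyadic
    approximations. *)
Let N : set Omega := \bigcup_k lim_sup_set (bad (gam k)).

Let mlim_sup (F : (set Omega)^nat) : (forall n, measurable (F n)) ->
  measurable (lim_sup_set F).
Proof.
by move=> mF; apply: bigcapT_measurable => n; apply: bigcup_measurable => k _.
Qed.

Let mN : measurable N.
Proof. by apply: bigcupT_measurable => k; exact: mlim_sup. Qed.

Let N0 : P.-negligible N.
Proof.
apply: negligible_bigcup => k; apply/negligibleP; first exact: mlim_sup.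
exact: bad_lim_sup0.
Qed.

(** From some level on, no increment is bad and all ratios are at most 1; the finitely many ratios
    below that level are simply added to the constant. *)
Let bounded_path (g : R) w : 0 < g -> g < lambda -> ~ N w ->
  exists2 G : R, 0 <= G &
  forall n k, (k < 2 ^ n)%N ->
  `|X (grid T n k.+1) w - X (grid T n k) w| <= G * mesh n `^ g.
Proof.
move=> g0 gl Nw; have [j gj] := gam_cofinal g0 gl.
have [n0 Hn0] : exists n0, forall n, (n0 <= n)%N -> ~ bad (gam j) n w.
  apply: contrapT => /forallNP h; apply: Nw; exists j => // n _.
  have /existsNP[m /not_implyP[nm /contrapT bm]] := h n.
  by exists m.
pose r n k : R := `|X (grid T n k.+1) w - X (grid T n k) w| / mesh n `^ g.
have r0 n k : 0 <= r n k by rewrite divr_ge0// powR_ge0.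
exists (1 + \sum_(n < n0) \sum_(k < 2 ^ n) r n k) => [|n k kn].
  by rewrite addr_ge0// sumr_ge0// => n _; rewrite sumr_ge0.
rewrite -ler_pdivrMr ?powR_gt0 ?mesh_gt0// -/(r n k).
have [nn0|nn0] := ltnP n n0.
  rewrite (bigD1 (Ordinal nn0))//= (bigD1 (Ordinal kn))//=.
  set S1 := \sum_(i < 2 ^ n | _) _; set S2 := \sum_(i < n0 | _) _.
  have S10 : 0 <= S1 by rewrite sumr_ge0.
  have S20 : 0 <= S2 by rewrite sumr_ge0// => i _; rewrite sumr_ge0.
  by rewrite [leRHS]addrCA -addrA lerDl addr_ge0// addr_ge0.
have : r n k <= 1.
  rewrite /r ler_pdivrMr ?powR_gt0 ?mesh_gt0// mul1r.
  have h : ~ mesh n `^ gam j <= `|X (grid T n k.+1) w - X (grid T n k) w|.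
    move=> h; apply: (Hn0 n nn0).
    pose A i := [set u | mesh n `^ gam j <= `|X (grid T n i.+1) u - X
      (grid T n i) u|].
    suff : (\bigcup_(i < (2 ^ n)%N) A i) w by rewrite bigcup_mkord.
    by exists k.
  move/negP: h; rewrite -ltNge => /ltW /le_trans; apply.
  (* As the mesh is at most 1, the larger exponent [gam j] gives the smaller power. *)
  by apply: ger_powR; rewrite ?mesh_gt0 ?mesh_le1// ltW.
by move=> /le_trans; apply; rewrite lerDl sumr_ge0// => i _; rewrite sumr_ge0.
Qed.

Let good_cvg w t : ~ N w -> 0 <= t -> t <= T -> cvgn (fun n =>
  X (grid_floor T n t) w).
Proof.
move=> Nw t0 tT; have [G G0 HG] := bounded_path (gam_gt0 0) (gam_lt 0) Nw.
exact: (dyadic_path_cvg T0 (x := fun u => X u w) (gam_gt0 0) G0 HG).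
Qed.

(** Multiplying by the indicator of the complement of [N] makes the sequence converge everywhere, so
    the limit is measurable and vanishes on [N]. Outside [0, T] any random variable will do. *)
Let limit_rv t : exists Y : {RV P >-> R}, 0 <= t -> t <= T ->
  (forall w, ~ N w -> X (grid_floor T n t) w @[n --> \oo] --> Y w) /\
  (forall w, N w -> Y w = 0).
Proof.
have [/andP[t0 tT]|tT] := boolP ((0 <= t) && (t <= T)); last first.
  exists (X 0) => t0 t1; by rewrite t0 t1 in tT.
pose Z n w := X (grid_floor T n t) w * \1_(~` N) w.
pose Y w := limn (Z ^~ w).
have ZY w : Z n w @[n --> \oo] --> Y w.
  have [Nw|Nw] := pselect (N w).
    have Z0 : Z ^~ w = cst 0 by apply/funext => n;
      rewrite /Z indicE memNset ?mulr0// => /(_ Nw).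
    by rewrite /Y Z0; apply: is_cvg_cst.
  rewrite /Y /Z indicE mem_set//; under eq_fun do rewrite mulr1.
  exact: good_cvg.
have mY : measurable_fun [set: Omega] Y.
  apply: (measurable_fun_cvg (h := Z)) => // n.
  by apply: measurable_funM => //; apply: measurable_indic; exact: measurableC.
pose Y' : {RV P >-> R} := HB.pack Y (isMeasurableFun.Build _ _ _ _ _ mY).
exists Y' => _ _; split => w Nw.
  have := ZY w; rewrite /Z indicE mem_set//; under eq_fun do rewrite mulr1.
  exact.
have := ZY w; have -> : Z ^~ w = cst 0.
  by apply/funext => n; rewrite /Z indicE memNset ?mulr0// => /(_ Nw).
by move=> Yw; apply/esym; apply: (cvg_unique _ _ Yw) => //; exact: cvg_cst.
Qed.

Lemma kolmogorov_continuity : exists Y : R -> {RV P >-> R},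
  modification_on `[0, T] X Y /\ holder_up_to `[0, T] lambda%:E Y.
Proof.
have [Y HY] := choice limit_rv; exists Y; split.
  move=> t /=; rewrite in_itv/= => /andP[t0 tT].
  have [Yc Y0] := HY t t0 tT.
  have [C C0 HC] := mesh_tail (gam_lt 0).
  (* Borel-Cantelli for the fixed [t]: almost surely X at the grid points below [t] converges to
     X_t, and the same sequence defines Y_t. The exceptional set may depend on [t], since only a
     modification is claimed. *)
  pose F n := [set w | mesh n `^ gam 0 <= `|X t w - X (grid_floor T n t) w|].
  have mF n : measurable (F n) by exact: mbig.
  have F0 : P (lim_sup_set F) = 0%E.
    apply: (lim_sup0 C0) => // n; apply: le_trans (HC n _ _ _ _ _ _) _.
    - exact: grid_ge0.
    - exact: grid_floor_le.
    - by [].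
    - exact: grid_floor_ge.
    rewrite lee_fin ler_wpM2l ?(ltW C0)// expr2 ler_piMr ?mesh_le1//.
    by rewrite ltW// mesh_gt0.
  have mE : measurable [set w | X t w = Y t w].
    rewrite -[X in measurable X]setTI.
    have mXY : measurable_fun [set: Omega] (fun w => X t w - Y t w)
      by exact: measurable_funB.
    rewrite (_ : [set w | X t w = Y t w] = (fun w =>
      X t w - Y t w) @^-1` [set 0]).
      exact: mXY.
    by apply/seteqP; split => w /= /eqP; rewrite ?subr_eq0 => /eqP // ->;
      rewrite subrr.
  have : P (~` [set w | X t w = Y t w]) = 0%E.
    apply: (measure_negligible (measurableC mE)).
    have sub : ~` [set w | X t w = Y t w] `<=` N `|` lim_sup_set F.
      move=> w /= XY; apply: contrapT => /not_orP[Nw Fw]; apply: XY.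
      have [n0 Hn0] : exists n0, forall n, (n0 <= n)%N -> ~ F n w.
        apply: contrapT => /forallNP h; apply: Fw => n _.
        have /existsNP[m /not_implyP[nm /contrapT bm]] := h n.
        by exists m.
      apply: (@cvg_unique _ _ (X (grid_floor T n t) w @[n --> \oo])) => //;
        last exact: Yc.
      apply/cvgrPdist_lt => e e0.
      have : (2^-1 `^ gam 0) ^+ n @[n --> \oo] --> (0 : R).
        apply: cvg_expr; rewrite ger0_norm ?powR_ge0//.
        have : 2^-1 `^ gam 0 < 1 `^ gam 0 :> R.
          by apply: gt0_ltr_powR; rewrite ?nnegrE ?invr_ge0// invf_lt1// ltr1n.
        by rewrite powR1.
      move=> /cvgr_lt/(_ e e0).
      have : \forall n \near \oo, ~ F n w by exists n0.
      apply: filterS2.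
      move=> n /= /negP; rewrite -ltNge => Fn; rewrite -mesh_powR => ne.
      exact: lt_trans ne.
    apply: (negligibleS sub); apply: negligibleU => //.
    by apply/negligibleP => //; exact: mlim_sup.
  move=> XY0; have := probability_setC P (measurableC mE).
  by rewrite setCK XY0 sube0.
move=> g g0; rewrite lte_fin => gl.
(* The Hoelder constant has to be a random variable, so it is built as a countable supremum of all
   grid ratios, enumerated through [unpickle]; the ratios are set to 0 on [N] to keep it finite
   everywhere. *)
pose h m w : R := if unpickle m is Some (n, k) then
  (if (k < 2 ^ n)%N then `|X (grid T n k.+1) w - X
    (grid T n k) w| / mesh n `^ g else 0)
  * \1_(~` N) w else 0.
have mh m : measurable_fun [set: Omega] (h m).
  rewrite /h; case: (unpickle m) => [[n k]|//].
  apply: measurable_funM; last by apply: measurable_indic; exact: measurableC.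
  by case: (k < 2 ^ n)%N => //; apply: measurable_funM.
have hub w : has_ubound (range (h ^~ w)).
  have [Nw|Nw] := pselect (N w).
    exists 0 => _ [m _ <-]; rewrite /h; case: (unpickle m) => [[n k]|//].
    by rewrite indicE memNset ?mulr0// => /(_ Nw).
  have [G G0 HG] := bounded_path g0 gl Nw.
  exists G => _ [m _ <-]; rewrite /h; case: (unpickle m) => [[n k]|//].
  rewrite indicE mem_set// mulr1; case: ifPn => // kn.
  by rewrite ler_pdivrMr ?powR_gt0 ?mesh_gt0// HG.
pose C w := dyadic_const T g * sups (h ^~ w) 0.
have mC : measurable_fun [set: Omega] C.
  by apply: measurable_funM => //; exact: measurable_fun_sups.
pose C' : {RV P >-> R} := HB.pack C (isMeasurableFun.Build _ _ _ _ _ mC).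
exists C'.
have hle m w : h m w <= sups (h ^~ w) 0.
  by apply: ub_le_sup; [exact/has_ubound_sdrop|exists m].
have C0 w : 0 <= sups (h ^~ w) 0.
  (* The pair (0, 1) is outside the grid, as 1 < 2^0 fails, so its entry is 0 and the supremum is
     nonnegative. *)
  apply: le_trans (hle (pickle (0, 1)%N) w).
  by rewrite /h pickleK/= mul0r.
suff HC w s t : 0 <= s -> s < t -> t <= T -> `|Y t w - Y s w| <= C w *
  (t - s) `^ g.
  move=> w s t /=; rewrite !in_itv/= => /andP[s0 sT] /andP[t0 tT].
  have [st|ts|->] := ltgtP s t.
  - by rewrite [X in _ * X `^ _]ger0_norm ?subr_ge0 ?(ltW st)//; exact: HC.
  - rewrite distrC [X in _ * X `^ _]distrC [X in _ * X `^ _]ger0_norm ?subr_ge0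
      ?(ltW ts)//.
    exact: HC.
  - by rewrite !subrr !normr0 powR0 ?gt_eqF// mulr0.
move=> s0 st tT; have t0 := ltW (le_lt_trans s0 st);
  have sT := ltW (lt_le_trans st tT).
have [Yt Yt0] := HY t t0 tT; have [Ys Ys0] := HY s s0 sT.
have [Nw|Nw] := pselect (N w).
  rewrite Yt0// Ys0// subrr normr0 mulr_ge0 ?powR_ge0// mulr_ge0//.
  exact: dyadic_const_ge0.
apply: (@dyadic_path_holder _ _ T0 (fun u => X u w) g _ g0 _ _ (fun u =>
  Y u w)) => //.
- move=> n k kn; rewrite -ler_pdivrMr ?powR_gt0 ?mesh_gt0//.
  apply: le_trans (hle (pickle (n, k)) w).
  by rewrite /h pickleK kn indicE mem_set// mulr1.
- exact: Ys.
- exact: Yt.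
Qed.

End kolmogorov_continuity.

(* [p^-1], [q^-1], [r^-1] are extended-real inverses: (+oo)^-1 = 0. *)
Theorem lemma1 (R : realType) (d : measure_display)
    (Omega : measurableType d) (P : probability Omega R)
    (W : R -> {RV P >-> R}) (hW : standard_wiener W)
    (T : R) (hT : 0 < T) (p q r : \bar R)
    (hp : (2%:E <= p)%E) (hq : (1%:E < q)%E) (hr : (1%:E <= r)%E)
    (hpr : ((1 / 2)%:E <= p^-1 + r^-1)%E)
    (hpqr : (p^-1 + q^-1 + r^-1 < (3 / 2)%:E)%E)
    (a b c : R -> R)
    (ha : Lp_on `[0, T] p a) (hb : Lp_on `[0, T] q b)
    (hc : Lp_on `[0, T] r c) :
  volterra_well_defined T a b c /\
  forall X : R -> {RV P >-> R},
    (forall t : R, t \in `[0, T] ->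
       is_wiener_integral W t (volterra_kernel a b c t) (X t)) ->
    exists Y : R -> {RV P >-> R},
      modification_on `[0, T] X Y /\
      holder_up_to `[0, T] ((3 / 2)%:E - p^-1 - q^-1 - r^-1)%E Y.
Proof.
split; first exact: volterra_kernel_well_defined hT hp hq hr hpr hpqr ha hb hc.
move=> X HX.
have [K [K0 HK]] := volterra_kernel_increment hT hp hq hr hpr hpqr ha hb hc.
have [pE _ _] := inve_ge (ltr0n _ 2 : 0 < 2 :> R) hp.
have [qE _ _] := inve_ge ltr01 (ltW hq).
have [rE _ _] := inve_ge ltr01 hr.
move: hpqr; rewrite pE qE rE -!EFinB -!EFinD lte_fin => hpqr'.
set lambda := 3 / 2 - fine (p^-1)%E - fine (q^-1)%E - fine (r^-1)%E in HK *.
have lambda0 : 0 < lambda by rewrite /lambda -!addrA -!opprD subr_gt0 addrA.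
have sK0 : 0 < Num.sqrt K by rewrite sqrtr_gt0.
(* The tail lemma is used with sigma = sqrt K (t - s)^lambda, and its scale is 4 sigma. *)
apply: (@kolmogorov_continuity _ _ _ _ X T lambda (4 * Num.sqrt K) hT lambda0).
  by rewrite mulr_gt0.
move=> s t x s0 st tT x0.
have ts0 : 0 < (t - s) `^ lambda by rewrite powR_gt0// subr_gt0.
rewrite -mulrA.
have t0 := ltW (le_lt_trans s0 st); have sT := ltW (lt_le_trans st tT).
apply: (wiener_integral_increment_tail hW sT tT _ x0 (HX t _) (HX s _)).
- exact: mulr_gt0.
- by rewrite in_itv/= t0.
- by rewrite in_itv/= s0.
rewrite exprMn sqr_sqrtr ?(ltW K0)// -(powR_mulrn 2 (powR_ge0 _ _)) -powRrM mulrC.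
rewrite (mulrC lambda) mulrC.
(* Both kernels are cut off within [0, T], so the integral over the line is the one over [0, T]. *)
apply: le_trans (HK s t s0 st tT); rewrite [leRHS]integral_mkcond le_eqVlt.
apply/orP; left; apply/eqP; apply: eq_integral => v _; rewrite [RHS]patchE.
case: ifPn => // vT; rewrite !patchE.
have nin u : u <= T -> v \in (`[0, u]%classic : set R) = false.
  move=> uT; apply: contraNF vT; rewrite !mem_setE !in_itv/= => /andP[-> vu].
  exact: le_trans uT.
by rewrite !nin// subr0 expr0n.
Qed.
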